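(* Assume $F$ is unknown to the bidder, satisfies Assumptions 1 and 2 (with constants $\Delta>0,c_f,C_f,\lambda$), and $F(b^*_{v,F})>0$. Then for any $\gamma>2$ and any $\epsilon>0$, the regret of UCBid1+ satisfies $R_T^{v,F}=O(T^{1/3+\epsilon})$ as $T\to\infty$.
   Context: Model: at rounds $t=1,\dots,T$ a bidder submits $B_t\in[0,1]$. $(V_t)$ i.i.d. in $[0,1]$ with mean $v$; $(M_t)$ i.i.d. in $[0,1]$ with CDF $F$, independent of $(V_t)$. If $M_t\le B_t$ the bidder wins, pays $B_t$, receives and observes $V_t$; otherwise she does not observe $V_t$. $M_t$ is observed at the end of every round. $U_{v,F}(b)=(v-b)F(b)$, $b^*_{v,F}=\max\{\operatorname{argmax}_{b\in[0,1]}U_{v,F}(b)\}$, $R_T^{v,F}=T\max_bU_{v,F}(b)-\sum_{t=1}^T\mathbb E[U_{v,F}(B_t)]$. Notation: $N_t=\sum_{s=1}^{t-1}\mathbf 1\{M_s\le B_s\}$, $\hat V_t=\frac1{N_t}\sum_{s=1}^{t-1}V_s\mathbf 1\{M_s\le B_s\}$, $\epsilon_t=\sqrt{\gamma\log(t-1)/(2N_t)}$, $\hat F_t(b)=\frac1{t-1}\sum_{s=1}^{t-1}\mathbf 1\{M_s<b\}$. Algorithm UCBid1+ (parameter $\gamma$): $B_1=1$ and for $t\ge2$, $B_t=\max\{\operatorname{argmax}_{b\in[0,1]}(\hat V_t+\epsilon_t-b)\hat F_t(b)\}$. Assumption 1: $F$ is continuously differentiable with density $f$ and strictly log-concave ($f/F$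 strictly decreasing on $(0,1)$). Assumption 2: $c_f<f(b)<C_f$ for $b\in[b^*_{v,F}-\Delta,b^*_{v,F}+\Delta]$, and $\phi_F:b\mapsto b+F(b)/f(b)$ has derivative at most $\lambda$ on $[b^*_{v,F},b^*_{v,F}+\Delta]$.
   Formalization: Since the empirical CDF uses M_s < b, the argmax defining B_t is often empty (the supremum is only approached as b decreases to some M_s); B_t is taken as the largest point of [0,1] at which the objective approaches its supremum, which equals the max argmax whenever that exists. *)

(* Defs.v *)
From HB Require Import structures.
From mathcomp Require Import all_boot all_order all_algebra.
From mathcomp Require Import all_classical all_reals all_analysis.
Set Implicit Arguments. Unset Strict Implicit. Unset Printing Implicit Defensive.
Import Order.TTheory GRing.Theory Num.Theory.
Import numFieldNormedType.Exports.
Local Open Scope classical_set_scope.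
Local Open Scope ring_scope.

Definition mutually_independent {d : measure_display} {Omega : measurableType d}
  {R : realType} (P : probability Omega R) {I : eqType} (S : set I)
  (X : I -> Omega -> R) : Prop :=
  forall (J : seq I) (A : I -> set R),
    {subset J <= S} -> uniq J -> (forall j, measurable (A j)) ->
    P (\bigcap_(j in [set` J]) (X j @^-1` A j)) =
    (\prod_(j <- J) P (X j @^-1` A j))%E.

Section Bid.
Variable R : realType.

Definition is_max_argmax (g : R -> R) (x : R) : Prop :=
  x \in `[0, 1] /\
  (forall b, b \in `[0, 1] -> g b <= g x) /\
  (forall b, b \in `[0, 1] -> g b = g x -> b <= x).

(** Points of [0,1] at which [g] approaches its supremum over [0,1]
    (= argmax of the upper-semicontinuous envelope of [g]). *)
Definition near_argmax (g : R -> R) : set R :=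
  [set b | b \in `[0, 1] /\
     forall e : R, 0 < e -> exists b', b' \in `[0, 1] /\ `|b' - b| < e /\
        sup [set g y | y in `[0, 1]] - e < g b'].

(** The bid "max argmax_{b in [0,1]} g(b)" (convention: argmax of the usc
    envelope). *)
Definition max_argmax_bid (g : R -> R) : R := sup (near_argmax g).

(** Empirical quantities at round [t] (1-based), given realizations
    [vs s], [ms s] (rounds s >= 1) and previous bids [bs] = [B_1; ...; B_{t-1}]. *)
Definition won (ms : nat -> R) (bs : seq R) (s : nat) : R :=
  (nat_of_bool (ms s <= nth 0 bs s.-1)%R)%:R.

Definition N_emp (ms : nat -> R) (bs : seq R) : R :=
  \sum_(1 <= s < (size bs).+1) won ms bs s.

Definition Vhat (vs ms : nat -> R) (bs : seq R) : R :=
  (\sum_(1 <= s < (size bs).+1) vs s * won ms bs s) / N_emp ms bs.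

Definition eps_conf (gamma : R) (ms : nat -> R) (bs : seq R) : R :=
  Num.sqrt (gamma * ln (size bs)%:R / (2 * N_emp ms bs)).

Definition Fhat (ms : nat -> R) (bs : seq R) (b : R) : R :=
  (\sum_(1 <= s < (size bs).+1) (nat_of_bool (ms s < b)%R)%:R) / (size bs)%:R.

Definition ucbid_next (gamma : R) (vs ms : nat -> R) (bs : seq R) : R :=
  if bs is [::] then 1 else
  max_argmax_bid (fun b => (Vhat vs ms bs + eps_conf gamma ms bs - b) * Fhat ms bs b).

Fixpoint ucbid_bids (gamma : R) (vs ms : nat -> R) (n : nat) : seq R :=
  if n is n'.+1 then
    let bs := ucbid_bids gamma vs ms n' in rcons bs (ucbid_next gamma vs ms bs)
  else [::].

Definition ucbid_bid (gamma : R) (vs ms : nat -> R) (t : nat) : R :=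
  nth 0 (ucbid_bids gamma vs ms t) t.-1.

Definition util (v : R) (F : R -> R) (b : R) : R := (v - b) * F b.

End Bid.

(** Regret R_T = T * max_b U(b) - sum_{t=1}^T E[U(B_t)], with max_b U = U(bstar). *)
Definition regret {d : measure_display} {Omega : measurableType d} {R : realType}
  (P : probability Omega R) (gamma v : R) (F : R -> R) (bstar : R)
  (V M : nat -> Omega -> R) (T : nat) : \bar R :=
  ((T%:R * util v F bstar)%:E -
   \sum_(1 <= t < T.+1)
      'E_P[fun w => util v F (ucbid_bid gamma (V ^~ w) (M ^~ w) t)])%E.

(* Main.v *)
(* Write U for the utility and b' for its largest maximizer. Bounding log F by
   its tangent at b' gives the quadratic gap U(b') - U(b) >= U(b') (b - b')^2 / 4.
   On a good round the bid is optimistic, and only the fluctuation of the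
   empirical distribution function between b' and B_t matters, not its error
   at each of the two points: it is of order sqrt(|B_t - b'| log t / t), since
   F is locally Lipschitz. Once a constant fraction of the rounds is won, the
   confidence width is of order sqrt(log t / t), hence the quadratic gap yields
   |B_t - b'| <= t^(-1/3) up to logarithms, and a round costs t^(-2/3).
   As the empirical distribution function is nondecreasing, it is enough to
   control it at the points k / n. The rounds that are not good are counted by
   sums of exponential supermartingales, which are at least 1 on them and whose
   expectation is O(1 / t). *)
Require Import Defs.
From HB Require Import structures.
From mathcomp Require Import all_boot all_order all_algebra.
From mathcomp Require Import all_classical all_reals all_analysis.
From mathcomp Require Import measurable_realfun ring lra zify.
Set Implicit Arguments. Unset Strict Implicit. Unset Printing Implicit Defensive.
Import Order.TTheory GRing.Theory Num.Theory.
Import numFieldNormedType.Exports.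
Local Open Scope classical_set_scope.
Local Open Scope ring_scope.

(** * Independence of the past and exponential supermartingales *)

(** The argument looks circular: bids are accurate only if the confidence width is small, the width
    is small only if many rounds were won, and rounds are won only if earlier bids were high enough.
    A one-sided estimate breaks the circle: below [bstar], optimism and monotonicity of the
    empirical distribution function already force a bid of at least [bstar / 2], whatever the width.
    Every sample below [bstar / 2] is then a win, up to rounds charged to earlier failures. Hence
    the cost of a round is bounded, outcome by outcome, by a power of [n], its own failure and the
    average of all earlier failures; probability enters only when this bound is integrated. The
    empirical function counts strict inequalities, so its mean is [G b], the probability of [M < b],
    instead of [F b]. They agree inside the unit interval, but [M] may have atoms at 0 and 1. The
    score is only left continuous and need not attain its supremum. The bid is therefore known only
    through approximate maximizers close to it, and its measurability needs countable
    approximations. *)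

Definition cylinders (Omega : Type) (I : choiceType) (R : realType)
    (X : I -> Omega -> R) (S : set I) : set (set Omega) :=
  [set C | exists (J : seq I) (A : I -> set R),
     [/\ {subset J <= S}, uniq J, forall j, measurable (A j) &
       C = \bigcap_(j in [set` J]) X j @^-1` A j]].

(** The cylinders are the pi-system generating the sigma-algebra of the coordinates in [S]; a
    coordinate absent from one of the two lists is constrained there by [setT]. *)
Lemma cylinders_setI_closed (Omega : Type) (I : choiceType) (R : realType)
  (X : I -> Omega -> R) (S : set I) : setI_closed (cylinders X S).
Proof.
move=> _ _ [J [A [JS uJ mA ->]]] [K [B [KS uK mB ->]]].
exists (undup (J ++ K)), (fun j => (if j \in J then A j else setT) `&`
  (if j \in K then B j else setT)); split.
- by move=> j; rewrite mem_undup mem_cat => /orP[/JS|/KS].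
- exact: undup_uniq.
- by move=> j; apply: measurableI; case: ifP.
- apply/seteqP; split => [w [wA wB] j /=|w wAB].
    rewrite mem_undup mem_cat => jJK; split; case: ifPn => //= jj.
      exact: wA.
    exact: wB.
  split=> j /= jj; (have /= : w \in (setT : set Omega) by rewrite inE);
    have := wAB j; rewrite /= mem_undup mem_cat jj ?orbT => /(_ isT) [];
    by [].
Qed.

Section independence.
Context {d : measure_display} {Omega : measurableType d} {R : realType}
  (P : probability Omega R) {I : choiceType}.
Variables (X : I -> Omega -> R) (T0 S : set I) (j0 : I).
Hypothesis indX : mutually_independent P T0 X.
Hypothesis mX : forall j, T0 j -> measurable_fun setT (X j).
Hypothesis ST0 : S `<=` T0.

Lemma sigma_cylinders_measurable A : <<s cylinders X S >> A -> measurable A.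
Proof.
suff: <<s cylinders X S >> `<=` measurable by apply.
apply: smallest_sub; first exact: sigma_algebra_measurable.
move=> _ [J [B [JS _ mB ->]]].
apply: (@fin_bigcap_measurable _ _ _ _ _) => //= j jJ.
rewrite -(setTI (_ @^-1` _)); apply: mX => //.
by apply/ST0/set_mem/JS.
Qed.

Hypotheses (Tj0 : T0 j0) (Sj0 : ~ S j0).

Lemma cylinders_indep (C : set Omega) (B : set R) :
  cylinders X S C -> measurable B ->
  P (C `&` X j0 @^-1` B) = (P C * P (X j0 @^-1` B))%E.
Proof.
move=> [J [A [JS uJ mA ->]]] mB.
have j0J : j0 \notin J by apply/negP => /JS /set_mem.
have AE j : j \in J -> (if j == j0 then B else A j) = A j.
  by case: eqP => [->|//]; rewrite (negbTE j0J).
have JT : {subset J <= T0} by move=> j /JS /set_mem /ST0 /mem_set.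
have E : P (\bigcap_(j in [set` j0 :: J])
      X j @^-1` (if j == j0 then B else A j)) =
    (\prod_(j <- j0 :: J) P (X j @^-1` (if j == j0 then B else A j)))%E.
  apply: (@indX (j0 :: J) (fun j => if j == j0 then B else A j)).
  - by move=> j; rewrite in_cons => /orP[/eqP ->|/JT//]; exact/mem_set.
  - by rewrite /= j0J.
  - by move=> j; case: ifP.
rewrite big_cons eqxx in E.
rewrite (@indX J A)// muleC.
rewrite (eq_big_seq (fun j => P (X j @^-1` (if j == j0 then B else A j)))); last first.
  by move=> j jJ; rewrite AE.
rewrite -E; congr (P _); apply/seteqP; split.
- move=> w [wA wB] j /=; rewrite inE; case: eqP => [->//|_ /= jJ].
  exact: wA.
- move=> w wA; split.
    by move=> j /= jJ; have := wA j; rewrite /= inE jJ orbT AE//; apply.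
  by have := wA j0; rewrite /= inE eqxx; apply.
Qed.

(** Dynkin's pi-lambda argument: for fixed [B], the events [A] satisfying the product rule contain
    the cylinders and are stable under complements and countable disjoint unions. *)
Lemma sigma_cylinders_indep (A : set Omega) (B : set R) :
  <<s cylinders X S >> A -> measurable B ->
  P (A `&` X j0 @^-1` B) = (P A * P (X j0 @^-1` B))%E.
Proof.
move=> sA mB.
have mXB : measurable (X j0 @^-1` B).
  by rewrite -(setTI (_ @^-1` _)); exact: mX.
pose T := g_sigma_algebraType (cylinders X S).
apply: (@dynkin_induction _ T (cylinders X S)
  (fun A => P (A `&` X j0 @^-1` B) = (P A * P (X j0 @^-1` B))%E)) sA => //.
- exact: cylinders_setI_closed.
- by rewrite setTI probability_setT mul1e.
- by move=> C sC; exact: cylinders_indep.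
- move=> C /sigma_cylinders_measurable mC E.
  have -> : P (~` C `&` X j0 @^-1` B) = (P (X j0 @^-1` B) - P (X j0 @^-1` B `&` C))%E.
    by rewrite setIC -setDE measureD// ltey_eq fin_num_measure.
  rewrite setIC E (probability_setC P mC) muleBl ?fin_num_measure//.
  by rewrite mul1e.
- move=> C mC tC E.
  have mC' n : @measurable _ Omega (C n) by exact: sigma_cylinders_measurable (mC n).
  rewrite setI_bigcupl measure_bigcup//; last 2 first.
    by move=> n _; exact: measurableI.
    exact: trivIset_setIr.
  rewrite measure_bigcup// muleC -(@fineK _ (P (X j0 @^-1` B))) ?fin_num_measure//.
  rewrite -nneseriesZl//.
  by apply: eq_eseriesr => n _; rewrite fineK ?fin_num_measure// muleC; exact: E.
Qed.

End independence.

Section product_rule.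
Context {d : measure_display} {Omega : measurableType d} {R : realType}
  (P : probability Omega R).
Local Open Scope ereal_scope.

(** The joint law agrees with the product of the two laws on rectangles, hence everywhere; Tonelli
    then separates the variables. *)
Lemma expectation_mul_indep (X Y : Omega -> R) :
  measurable_fun setT X -> measurable_fun setT Y ->
  (forall w, 0 <= X w)%R -> (forall w, 0 <= Y w)%R ->
  (forall A B : set R, measurable A -> measurable B ->
    P (X @^-1` A `&` Y @^-1` B) = P (X @^-1` A) * P (Y @^-1` B)) ->
  \int[P]_w (X w * Y w)%:E = \int[P]_w (X w)%:E * \int[P]_w (Y w)%:E.
Proof.
move=> mX mY X0 Y0 XY.
pose X' : {mfun Omega >-> R} := mfun_Sub (mem_set mX).
pose Y' : {mfun Omega >-> R} := mfun_Sub (mem_set mY).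
pose PX := distribution P X'.
pose PY := distribution P Y'.
have mXY : measurable_fun setT (fun w => (X w, Y w)).
  exact/measurable_fun_pairP.
pose XY' : {mfun Omega >-> (R * R)%type} := mfun_Sub (mem_set mXY).
pose Q := distribution P XY'.
have E : forall C, measurable C -> (PX \x PY)%E C = Q C.
  apply: product_measure_unique => A B mA mB /=.
  by rewrite /Q /PX /PY /distribution /pushforward/= -XY.
(* The absolute values make the integrand nonnegative on the whole plane, as Tonelli requires, and
   change nothing on the range of [X] and [Y]. *)
pose h (z : R * R) : \bar R := (`|z.1| * `|z.2|)%:E.
have mh : measurable_fun setT h.
  apply/measurable_EFinP/measurable_funM;
    by apply: measurableT_comp => //; exact: normr_measurable.
transitivity (\int[Q]_z h z).
  rewrite ge0_integral_distribution//; last by move=> z; rewrite lee_fin mulr_ge0.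
  apply: eq_integral => w _ /=.
  by rewrite /h/= !ger0_norm.
transitivity (\int[(PX \x PY)%E]_z h z).
  by apply: eq_measure_integral => A mA _; exact/esym/E.
rewrite fubini_tonelli1//; last by move=> z; rewrite lee_fin mulr_ge0.
rewrite /fubini_F/=.
have mn : measurable_fun setT (fun x : R => `|x|%:E : \bar R).
  by apply/measurable_EFinP; exact: normr_measurable.
under eq_integral => x _.
  under eq_integral => y _ do rewrite /h/= EFinM.
  rewrite ge0_integralZl//.
  over.
rewrite ge0_integralZr//; last by exact: integral_ge0.
rewrite !ge0_integral_distribution//.
by congr (_ * _); apply: eq_integral => w _ /=; rewrite ger0_norm.
Qed.

End product_rule.

Section supermartingale.
Context {d : measure_display} {Omega : measurableType d} {R : realType}
  (P : probability Omega R) {I : choiceType}.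
Variables (X : I -> Omega -> R) (T0 : set I).
Hypothesis indX : mutually_independent P T0 X.
Hypothesis mX : forall j, T0 j -> measurable_fun setT (X j).
Local Open Scope ereal_scope.

Lemma measurable_fun_sigma (S : set I) (G : Omega -> R) : S `<=` T0 ->
  measurable_fun (setT : set (g_sigma_algebraType (cylinders X S))) G ->
  measurable_fun (setT : set Omega) G.
Proof.
move=> ST0 mG _ B mB; have := mG measurableT B mB.
exact: (sigma_cylinders_measurable mX ST0).
Qed.

Lemma expectation_sigma_indep (S : set I) (j : I) (G : Omega -> R) (h : R -> R) :
  S `<=` T0 -> T0 j -> ~ S j ->
  measurable_fun (setT : set (g_sigma_algebraType (cylinders X S))) G ->
  measurable_fun setT h ->
  (forall w, 0 <= G w)%R -> (forall x, 0 <= h x)%R ->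
  \int[P]_w (G w * h (X j w))%:E =
  \int[P]_w (G w)%:E * \int[P]_w (h (X j w))%:E.
Proof.
move=> ST0 Tj Sj mG mh G0 h0; apply: expectation_mul_indep => //.
- exact: measurable_fun_sigma mG.
- by apply: measurableT_comp => //; exact: mX.
- move=> A B mA mB; rewrite [_ @^-1` B](_ : _ = X j @^-1` (h @^-1` B))//.
  apply: (sigma_cylinders_indep indX mX ST0) => //.
    by rewrite -[X in <<s _ >> X](setTI); exact: mG.
  by rewrite -[X in measurable X](setTI); exact: mh.
Qed.

(** [W] is a predictable switch, later the indicator of a win. The integrand splits into
    [G * (1 - W)], left alone, and [G * W] times a fresh independent factor of mean at most 1. *)
Lemma supermartingale_step (S : set I) (j : I) (G W : Omega -> R) (h : R -> R) :
  S `<=` T0 -> T0 j -> ~ S j ->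
  measurable_fun (setT : set (g_sigma_algebraType (cylinders X S))) G ->
  measurable_fun (setT : set (g_sigma_algebraType (cylinders X S))) W ->
  measurable_fun setT h ->
  (forall w, 0 <= G w)%R -> (forall w, 0 <= W w <= 1)%R ->
  (forall x, 0 <= h x)%R ->
  \int[P]_w (h (X j w))%:E <= 1 ->
  \int[P]_w (G w * (1 + W w * (h (X j w) - 1)))%:E <= \int[P]_w (G w)%:E.
Proof.
move=> ST0 Tj Sj mG mW mh G0 W01 h0 Eh.
have W0 w : (0 <= W w)%R by case/andP: (W01 w).
have W1 w : (W w <= 1)%R by case/andP: (W01 w).
have mGS := measurable_fun_sigma ST0 mG.
have mWS := measurable_fun_sigma ST0 mW.
have mhX : measurable_fun setT (fun w => h (X j w)).
  by apply: measurableT_comp => //; exact: mX.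
under eq_integral => w _.
  rewrite (_ : _ * _ = G w * (1 - W w) + (G w * W w) * h (X j w))%R; last by ring.
  rewrite EFinD; over.
rewrite ge0_integralD//=; last 4 first.
- by move=> w _; rewrite lee_fin mulr_ge0// subr_ge0.
- by apply/measurable_EFinP/measurable_funM => //; exact: measurable_funB.
- by move=> w _; rewrite lee_fin !mulr_ge0.
- by apply/measurable_EFinP; do 2 apply: measurable_funM => //.
rewrite (@expectation_sigma_indep S j (fun w => G w * W w)%R)//; last 2 first.
- exact: measurable_funM.
- by move=> w; rewrite mulr_ge0.
apply: (@le_trans _ _ (\int[P]_w (G w * (1 - W w))%:E + \int[P]_w (G w * W w)%:E)).
  apply: leeD => //; rewrite -[leRHS]mule1; apply: lee_wpmul2l => //.
  by apply: integral_ge0 => w _; rewrite lee_fin mulr_ge0.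
rewrite -ge0_integralD//=.
- by under eq_integral do rewrite -EFinD -mulrDr subrK mulr1.
- by move=> w _; rewrite lee_fin mulr_ge0// subr_ge0.
- by apply/measurable_EFinP/measurable_funM => //; exact: measurable_funB.
- by move=> w _; rewrite lee_fin !mulr_ge0.
- by apply/measurable_EFinP/measurable_funM.
Qed.

Lemma measurable_fun_sigma_mono (S S' : set I) (G : Omega -> R) : S `<=` S' ->
  measurable_fun (setT : set (g_sigma_algebraType (cylinders X S))) G ->
  measurable_fun (setT : set (g_sigma_algebraType (cylinders X S'))) G.
Proof.
move=> SS' mG _ B mB; have := mG measurableT B mB.
apply: sub_smallest2r; first exact: smallest_sigma_algebra.
move=> _ [J [A [JS uJ mA ->]]]; exists J, A; split => // j /JS /set_mem /SS'.
exact: mem_set.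
Qed.

Lemma measurable_fun_sigma_coord (S : set I) (j : I) : S j ->
  measurable_fun (setT : set (g_sigma_algebraType (cylinders X S))) (X j).
Proof.
move=> Sj _ B mB; rewrite setTI; apply: sub_gen_smallest.
exists [:: j], (fun=> B); split => //.
- by move=> i; rewrite mem_seq1 => /eqP ->; exact: mem_set.
- apply/seteqP; split => [w Bw i /=|w Bw].
    by rewrite mem_seq1 => /eqP ->.
  by apply: (Bw j); rewrite /= mem_seq1.
Qed.

(** [S s] is the information available before the coordinate [j s] is revealed. The product of the
    first [n] factors involves only coordinates of [S n.+1], so the last factor can be integrated
    out first. *)
Lemma supermartingale_prod (S : nat -> set I) (j : nat -> I)
    (W : nat -> Omega -> R) (h : nat -> R -> R) (n : nat) :
  (forall s, (1 <= s)%N -> [/\ S s `<=` T0, T0 (j s) & ~ S s (j s)]) ->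
  (forall r s, (1 <= r < s)%N -> S r `<=` S s /\ S s (j r)) ->
  (forall s, (1 <= s)%N ->
    measurable_fun (setT : set (g_sigma_algebraType (cylinders X (S s)))) (W s)) ->
  (forall s, (1 <= s)%N -> measurable_fun setT (h s)) ->
  (forall s w, (1 <= s)%N -> (0 <= W s w <= 1)%R) ->
  (forall s x, (1 <= s)%N -> (0 <= h s x)%R) ->
  (forall s, (1 <= s)%N -> \int[P]_w (h s (X (j s) w))%:E <= 1) ->
  \int[P]_w (\prod_(1 <= s < n.+1) (1 + W s w * (h s (X (j s) w) - 1)))%:E <= 1.
Proof.
move=> HS Hmono mW mh W01 h0 Eh.
elim: n => [|n ih].
  under eq_integral do rewrite big_geq//.
  by rewrite integral_cst// mul1e probability_le1.
under eq_integral do rewrite big_nat_recr//=.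
have [ST Tj Sj] := HS n.+1 isT.
apply: le_trans ih; apply: (supermartingale_step ST Tj Sj) => //.
- apply: measurable_prod => s; rewrite mem_index_iota => /andP[s1 sn].
  have [Ss Sjs] : S s `<=` S n.+1 /\ S n.+1 (j s) by apply: Hmono; rewrite s1.
  apply: measurable_funD => //; apply: measurable_funM.
    by apply: measurable_fun_sigma_mono Ss _; exact: mW.
  apply: measurable_funB => //; apply: measurableT_comp; first exact: mh.
  exact: measurable_fun_sigma_coord.
- exact: mW.
- exact: mh.
- move=> w; rewrite big_nat_cond prodr_ge0// => s /andP[/andP[s1 _] _].
  have /andP[W0 W1] := W01 s w s1.
  have := h0 s (X (j s) w) s1; nra.
- by move=> w; exact: W01.
- by move=> x; exact: h0.
- exact: Eh.
Qed.

End supermartingale.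

(** * Largest near-maximizers *)

Section near_argmax_theory.
Context {R : realType}.
Variables (g : R -> R) (K : R).
Hypothesis gK : forall b, b \in `[0, 1] -> g b <= K.

Let gsup := sup [set g y | y in `[0, 1]].

Lemma near_argmax_has_sup : has_sup [set g y | y in `[0, 1]].
Proof.
split; first by exists (g 0), 0 => //=; rewrite in_itv/= lexx ler01.
by exists K => _ [y /= y01 <-]; exact: gK.
Qed.

Lemma le_near_argmax_sup b : 0 <= b <= 1 -> g b <= gsup.
Proof.
move=> b01; apply: ub_le_sup; first by case: near_argmax_has_sup.
by exists b => //=; rewrite in_itv.
Qed.

Lemma near_argmax_sup_adherent e : 0 < e ->
  exists b, 0 <= b <= 1 /\ gsup - e < g b.
Proof.
move=> e0; have [_ [b /= b01 <-] ?] := sup_adherent e0 near_argmax_has_sup.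
by exists b; rewrite in_itv/= in b01.
Qed.

(** A compactness argument: among the points to the right of which [g] still comes arbitrarily close
    to its supremum, the least upper bound is itself in [near_argmax g]. *)
Lemma near_argmax_ge q : 0 <= q <= 1 ->
  (forall e, 0 < e -> exists b, q <= b <= 1 /\ gsup - e < g b) ->
  exists2 x, near_argmax g x & q <= x.
Proof.
move=> /andP[q0 q1] H.
pose A := [set x : R | q <= x <= 1 /\
  forall e, 0 < e -> exists b, x <= b <= 1 /\ gsup - e < g b].
have Aq : A q by split => //; rewrite lexx.
have hA : has_sup A by split; [exists q|exists 1 => x [/andP[]]].
have qA : q <= sup A by apply: ub_le_sup => //; case: hA.
have A1 : sup A <= 1 by apply: ge_sup; [exists q|move=> x [/andP[]]].
exists (sup A) => //; split; first by rewrite in_itv/= A1 (le_trans q0).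
move=> e e0.
(* Past [sup A + e / 2] the values of [g] stay below the supremum by a fixed [e1], so approximate
   maximizers sought from just left of [sup A] lie within [e] of it. *)
have [e1 e10 He1] : exists2 e1, 0 < e1 & forall b, sup A + e / 2 <= b <= 1 ->
    g b <= gsup - e1.
  have [le1|gt1] := leP (sup A + e / 2) 1; last first.
    by exists 1 => // b /andP[]; lra.
  have nA : ~ A (sup A + e / 2).
    move=> As; have : sup A + e / 2 <= sup A by apply: ub_le_sup => //; case: hA.
    lra.
  apply: contrapT => nH; apply: nA; split; first by rewrite le1 (le_trans qA)//; lra.
  move=> e2 e20; apply: contrapT => nb; apply: nH; exists e2 => // b b1.
  by rewrite leNgt; apply/negP => gb; apply: nb; exists b.
pose e2 := Num.min e e1.
have e20 : 0 < e2 by rewrite lt_min e0.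
have [a [/andP[qa a1] Ha]] := sup_adherent e0 hA.
move=> aS; have [b [/andP[ab b1] gb]] := Ha e2 e20.
have e2e : e2 <= e by rewrite ge_min lexx.
have e2e1 : e2 <= e1 by rewrite ge_min lexx orbT.
exists b; split; first by rewrite in_itv/= b1 (le_trans q0)// (le_trans qa).
split; last by rewrite -/gsup; lra.
have bS : b < sup A + e / 2.
  rewrite ltNge; apply/negP => Sb.
  have : g b <= gsup - e1 by apply: He1; rewrite Sb.
  lra.
by rewrite ltr_norml; apply/andP; split; lra.
Qed.

Lemma near_argmax_sub01 : near_argmax g `<=` `[0, 1].
Proof. by move=> b []. Qed.

Lemma has_sup_near_argmax : has_sup (near_argmax g).
Proof.
split.
  have [|e e0|x nx _] := @near_argmax_ge 0; first by rewrite lexx ler01.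
    exact: near_argmax_sup_adherent.
  by exists x.
by exists 1 => b /near_argmax_sub01 /=; rewrite in_itv/= => /andP[].
Qed.

Lemma near_argmax_le_bid b : near_argmax g b -> b <= max_argmax_bid g.
Proof. by move=> gb; apply: ub_le_sup => //; case: has_sup_near_argmax. Qed.

Lemma max_argmax_bid01 : 0 <= max_argmax_bid g <= 1.
Proof.
have [[x nx] _] := has_sup_near_argmax; apply/andP; split.
  apply: le_trans (near_argmax_le_bid nx).
  by have /= := near_argmax_sub01 nx; rewrite in_itv/= => /andP[].
apply: ge_sup; first by exists x.
by move=> b /near_argmax_sub01 /=; rewrite in_itv/= => /andP[].
Qed.

Lemma max_argmax_bid_approx e : 0 < e -> exists b, [/\ 0 <= b <= 1,
  `|b - max_argmax_bid g| < e & gsup - e < g b].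
Proof.
move=> e0; have e20 : 0 < e / 2 by lra.
have [x [x01 Hx]] := sup_adherent e20 has_sup_near_argmax.
rewrite -/(max_argmax_bid g) => Bx.
have xB : x <= max_argmax_bid g by apply: near_argmax_le_bid.
have [b [b01 [bx gb]]] := Hx _ e20.
exists b; split; [by rewrite in_itv/= in b01| |by rewrite -/gsup in gb; lra].
by move: bx; rewrite !ltr_norml => /andP[? ?]; apply/andP; split; lra.
Qed.

Hypothesis gleft : forall b, 0 < b <= 1 ->
  exists2 dl, 0 < dl & forall r, b - dl < r <= b -> 0 <= r -> g b <= g r.

(** Just to the left of [b] the values are at least [g b], so passing to a rational there loses
    nothing; [b = 0] is itself rational. *)
Lemma left_rational_ge q b : q < b -> 0 <= b <= 1 ->
  exists r : rat, [/\ q < ratr r, 0 <= (ratr r : R) <= 1 & g b <= g (ratr r)].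
Proof.
move=> qb /andP[b0 b1]; move: b0 qb; rewrite le_eqVlt => /predU1P[<-|b0] qb.
  by exists 0; rewrite rmorph0; split; rewrite ?lexx ?ler01.
have [|dl dl0 H] := gleft (b := b); first by rewrite b0.
have : Num.max q (Num.max 0 (b - dl)) < b.
  by rewrite !gt_max qb b0/=; lra.
move=> /rat_in_itvoo [r]; rewrite in_itv/= !gt_max => /andP[/and3P[qr r0 br] rb].
exists r; split => //; first by rewrite (ltW r0) (le_trans (ltW rb)).
by apply: H; [rewrite br ltW|exact: ltW].
Qed.

(** All quantifiers range over countable sets, which makes the bid measurable: some value
    [g (ratr r)] beats by a fixed margin all values at rationals beyond some [q < x]. *)
Lemma max_argmax_bid_ltP x : max_argmax_bid g < x <->
  exists (q r : rat) (k : nat), [/\ ratr q < x, 0 <= (ratr r : R) <= 1 &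
    forall r' : rat, 0 <= (ratr r' : R) <= 1 -> ratr q < ratr r' :> R ->
      g (ratr r') + k.+1%:R^-1 <= g (ratr r)].
Proof.
split => [Bx|[q [r [k [qx r01 H]]]]].
  have [q] := rat_in_itvoo Bx; rewrite in_itv/= => /andP[Bq qx].
  (* No point of the unit interval lies beyond such a [q], and the condition is vacuous. *)
  have [q1|q1] := leP 1 (ratr q : R).
    exists q, 0, 0; rewrite rmorph0 lexx ler01; split => // r' /andP[_ r1] qr.
    by have := lt_le_trans qr r1; rewrite ltNge q1.
  have q0 : 0 <= ratr q :> R.
    by rewrite (le_trans _ (ltW Bq))//; case/andP: max_argmax_bid01.
  have [e e0 He] : exists2 e, 0 < e & forall b, ratr q <= b <= 1 -> g b <= gsup - e.
    apply: contrapT => nH.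
    have [||y ny qy] := @near_argmax_ge (ratr q); first by rewrite q0 ltW.
      move=> e e0; apply: contrapT => nb; apply: nH; exists e => // b b1.
      by rewrite leNgt; apply/negP => gb; apply: nb; exists b.
    by have := near_argmax_le_bid ny; rewrite leNgt (lt_le_trans Bq qy).
  have e20 : 0 < e / 2 by lra.
  have [k ke] : exists k : nat, k.+1%:R^-1 < e / 2.
    by have [k] := ltr_add_invr (y := 0) e20; rewrite add0r; exists k.
  have [b [b01 gb]] := near_argmax_sup_adherent e20.
  have [|r [_ r01 gr]] := @left_rational_ge (-1) b _ b01.
    by case/andP: b01; lra.
  exists q, r, k; split => // r' /andP[_ r'1] qr'.
  have : g (ratr r') <= gsup - e by apply: He; rewrite (ltW qr').
  by move: (k.+1%:R^-1) ke => z; lra.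
rewrite ltNge; apply/negP => xB.
have qB : ratr q < max_argmax_bid g by exact: lt_le_trans xB.
have k0 : 0 < k.+1%:R^-1 :> R by rewrite invr_gt0.
pose e := Num.min (max_argmax_bid g - ratr q) k.+1%:R^-1.
have e0 : 0 < e by rewrite lt_min k0 subr_gt0 qB.
have [b [b01 bB gb]] := max_argmax_bid_approx e0.
have eq1 : e <= max_argmax_bid g - ratr q by rewrite ge_min lexx.
have ek : e <= k.+1%:R^-1 by rewrite ge_min lexx orbT.
have qb : ratr q < b by move: bB; rewrite ltr_norml => /andP[]; lra.
have [r' [qr' r'01 gr']] := left_rational_ge qb b01.
have := H r' r'01 qr'; have := le_near_argmax_sup r01.
by move: (k.+1%:R^-1) ek => z; lra.
Qed.

End near_argmax_theory.

Lemma measurable_fun_from_ltr (R : realType) d (T : measurableType d) (h : T -> R) :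
  (forall x, measurable [set w | h w < x]) -> measurable_fun setT h.
Proof.
move=> H; apply: (measurability _ (RGenInftyO.measurableE R)) => //.
move=> _ [_ [x ->] <-]; rewrite setTI.
by rewrite (_ : _ @^-1` _ = [set w | h w < x])//; apply/seteqP; split=> w /=;
  rewrite in_itv.
Qed.

Lemma measurable_max_argmax_bid (R : realType) d (T : measurableType d)
    (g : T -> R -> R) (K : T -> R) :
  (forall b, measurable_fun setT (g ^~ b)) ->
  (forall w b, b \in `[0, 1] -> g w b <= K w) ->
  (forall w b, 0 < b <= 1 -> exists2 dl, 0 < dl &
     forall r, b - dl < r <= b -> 0 <= r -> g w b <= g w r) ->
  measurable_fun setT (fun w => max_argmax_bid (g w)).
Proof.
move=> mg gK gl; apply: measurable_fun_from_ltr => x.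
rewrite (_ : [set w | _] = \bigcup_(q : rat) \bigcup_(r : rat) \bigcup_(k : nat)
  [set w | (ratr q < x /\ 0 <= (ratr r : R) <= 1) /\
    forall r' : rat, (0 <= (ratr r' : R) <= 1 /\ ratr q < ratr r' :> R) ->
      g w (ratr r') + k.+1%:R^-1 <= g w (ratr r)]); last first.
  apply/seteqP; split => w /=.
    move=> /(max_argmax_bid_ltP (gK w) (gl w)) [q [r [k [? ? H]]]].
    exists q => //; exists r => //; exists k => //; split => // r' [? ?].
    exact: H.
  move=> [q _ [r _ [k _ [[? ?] H]]]].
  apply/(max_argmax_bid_ltP (gK w) (gl w)); exists q, r, k; split => // r' ? ?.
  exact: H.
apply: countable_bigcupT_measurable => [|q]; first exact: countableP.
apply: countable_bigcupT_measurable => [|r]; first exact: countableP.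
apply: bigcup_measurable => k _.
have [C|C] := pselect (ratr q < x /\ 0 <= (ratr r : R) <= 1); last first.
  by rewrite (_ : [set w | _] = set0)//; apply/seteqP; split => w //= [].
rewrite (_ : [set w | _] = ~` \bigcup_(r' : rat)
    [set w | (0 <= (ratr r' : R) <= 1 /\ ratr q < ratr r' :> R) /\
      g w (ratr r) < g w (ratr r') + k.+1%:R^-1]); last first.
  apply/seteqP; split => w /=.
    by move=> [_ H] [r' _ /= [/H]]; rewrite leNgt => /negP.
  move=> H; split => // r' Hr'; rewrite leNgt; apply/negP => lt.
  by apply: H; exists r'.
apply: measurableC; apply: countable_bigcupT_measurable => [|r']; first exact: countableP.
have [C'|C'] := pselect (0 <= (ratr r' : R) <= 1 /\ ratr q < ratr r' :> R); last first.
  by rewrite (_ : [set w | _] = set0)//; apply/seteqP; split => w //= [].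
rewrite (_ : [set w | _] =
    (fun w => g w (ratr r) < g w (ratr r') + k.+1%:R^-1) @^-1` [set true]); last first.
  by apply/seteqP; split => w /= => [[]|].
rewrite -[X in measurable X]setTI.
by apply: measurable_fun_ltr => //; apply: measurable_funD.
Qed.

(** * The algorithm indexed by rounds, and measurability of its bids *)

Section ucbid_bids.
Context {R : realType}.
Implicit Types (gamma b : R) (vs ms : nat -> R).

Lemma size_ucbid_bids gamma vs ms n : size (ucbid_bids gamma vs ms n) = n.
Proof. by elim: n => //= n ih; rewrite size_rcons ih. Qed.

Lemma nth_ucbid_bids gamma vs ms n i : (i < n)%N ->
  nth 0 (ucbid_bids gamma vs ms n) i = ucbid_bid gamma vs ms i.+1.
Proof.
elim: n => // n ih; rewrite ltnS leq_eqVlt => /predU1P[->//|ni].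
by rewrite /= nth_rcons size_ucbid_bids ni ih.
Qed.

Definition win gamma vs ms s : R := (nat_of_bool (ms s <= ucbid_bid gamma vs ms s)%R)%:R.

Definition wins gamma vs ms n : R := \sum_(1 <= s < n.+1) win gamma vs ms s.

Definition ucb gamma vs ms n : R :=
  (\sum_(1 <= s < n.+1) vs s * win gamma vs ms s) / wins gamma vs ms n +
  Num.sqrt (gamma * ln n%:R / (2 * wins gamma vs ms n)).

Definition ecdf ms n b : R := (\sum_(1 <= s < n.+1) (nat_of_bool (ms s < b)%R)%:R) / n%:R.

Lemma ucbid_bid1 gamma vs ms : ucbid_bid gamma vs ms 1 = 1.
Proof. by []. Qed.

Lemma won_ucbid_bids gamma vs ms n s : (1 <= s < n.+1)%N ->
  won ms (ucbid_bids gamma vs ms n) s = win gamma vs ms s.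
Proof. by case: s => [//|s] sn; rewrite /won nth_ucbid_bids. Qed.

Lemma ucbid_bidS gamma vs ms n : (0 < n)%N -> ucbid_bid gamma vs ms n.+1 =
  max_argmax_bid (fun b => (ucb gamma vs ms n - b) * ecdf ms n b).
Proof.
move=> n0; rewrite /ucbid_bid /= nth_rcons size_ucbid_bids ltnn eqxx.
rewrite /ucbid_next; have := size_ucbid_bids gamma vs ms n.
case E : (ucbid_bids gamma vs ms n) => [|x s] /= sz; first by rewrite -sz in n0.
have NE : N_emp ms (ucbid_bids gamma vs ms n) = wins gamma vs ms n.
  by rewrite /N_emp size_ucbid_bids; apply: eq_big_nat => i; exact: won_ucbid_bids.
congr max_argmax_bid; apply/funext => b; rewrite -E; congr (_ * _); last first.
  by rewrite /Fhat size_ucbid_bids.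
congr (_ - _); rewrite /ucb /Vhat /eps_conf NE !size_ucbid_bids; congr (_ / _ + _).
by apply: eq_big_nat => i ?; rewrite won_ucbid_bids.
Qed.

Lemma ecdf_ge0 ms n b : 0 <= ecdf ms n b.
Proof. by rewrite divr_ge0// sumr_ge0. Qed.

Lemma ecdf_le1 ms n b : ecdf ms n b <= 1.
Proof.
case: n => [|n]; first by rewrite /ecdf invr0 mulr0.
rewrite ler_pdivrMr// mul1r (@le_trans _ _ (\sum_(1 <= s < n.+2) 1))//.
  by apply: ler_sum => i _; case: (_ < _).
by rewrite big_const_nat iter_addr addr0 subn1.
Qed.

Lemma ecdf_mono ms n : {homo ecdf ms n : b b' / b <= b'}.
Proof.
move=> b b' bb'; rewrite ler_wpM2r// ler_sum// => i _.
by case: (ltP (ms i) b) => // /lt_le_trans/(_ bb') ->.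
Qed.

(** The finitely many samples strictly below [b] are separated from it by some [dl]; the strict
    inequality in [ecdf] gives constancy on the left. *)
Lemma ecdf_left_const ms n b : exists2 dl, 0 < dl &
  forall r, b - dl < r <= b -> ecdf ms n r = ecdf ms n b.
Proof.
have [dl dl0 H] : exists2 dl, 0 < dl &
    forall s, (1 <= s < n.+1)%N -> ms s < b -> ms s <= b - dl.
  elim: n => [|n [dl dl0 ih]]; first by exists 1 => // s /andP[]; case: s.
  have [mb|bm] := ltP (ms n.+1) b; last first.
    exists dl => // s /andP[s1]; rewrite ltnS leq_eqVlt => /predU1P[->|sn].
      by move=> /lt_le_trans/(_ bm); rewrite ltxx.
    by apply: ih; rewrite s1.
  exists (Num.min dl (b - ms n.+1)); first by rewrite lt_min dl0 subr_gt0.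
  move=> s /andP[s1]; rewrite ltnS leq_eqVlt => /predU1P[->|sn].
    by move=> _; rewrite lerBrDl -lerBrDr ge_min lexx orbT.
  move=> msb; have := ih s; rewrite s1 => /(_ sn msb) /le_trans; apply.
  by rewrite lerD2l lerN2 ge_min lexx.
exists dl => // r /andP[br rb]; rewrite /ecdf; congr (_ / _).
apply: eq_big_nat => s sn; congr (nat_of_bool _)%:R; apply/idP/idP.
  by move=> /lt_le_trans; apply.
by move=> /(H s sn) /le_lt_trans; apply.
Qed.

Lemma score_le ms n (w b : R) : b \in `[0, 1] -> (w - b) * ecdf ms n b <= `|w|.
Proof.
rewrite in_itv/= => /andP[b0 b1].
have := ecdf_ge0 ms n b; have := ecdf_le1 ms n b.
move: (ecdf _ _ _) => e e1 e0; have := ler_norm w; have := normr_ge0 w; nra.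
Qed.

Lemma score_left ms n (w b : R) : 0 < b <= 1 -> exists2 dl, 0 < dl &
  forall r, b - dl < r <= b -> 0 <= r ->
    (w - b) * ecdf ms n b <= (w - r) * ecdf ms n r.
Proof.
move=> _; have [dl dl0 H] := ecdf_left_const ms n b; exists dl => // r br _.
by rewrite (H r br) ler_wpM2r ?ecdf_ge0// lerD2l lerN2; case/andP: br.
Qed.

Lemma ucbid_bid01 gamma vs ms t : (1 <= t)%N -> 0 <= ucbid_bid gamma vs ms t <= 1.
Proof.
case: t => [//|[|n] _]; first by rewrite ucbid_bid1 ler01 lexx.
by rewrite ucbid_bidS//; apply: max_argmax_bid01 => b; exact: score_le.
Qed.

Lemma win_01 gamma vs ms s : 0 <= win gamma vs ms s <= 1.
Proof. by rewrite ler0n lern1 leq_b1. Qed.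

Section measurability.
Context d (T : measurableType d) (V M : nat -> T -> R).

Lemma measurable_nat_of_bool (B : T -> bool) :
  measurable_fun setT B -> measurable_fun setT (fun w => (B w)%:R : R).
Proof.
move=> mB; rewrite (_ : (fun _ => _) = fun w => if B w then 1 else 0); last first.
  by apply/funext => w; case: (B w).
by apply: measurable_fun_ifT.
Qed.

Lemma measurable_bigsum_nat (n : nat) (h : nat -> T -> R) :
  (forall s, (1 <= s < n.+1)%N -> measurable_fun setT (h s)) ->
  measurable_fun setT (fun w => \sum_(1 <= s < n.+1) h s w).
Proof.
elim: n => [_|n ih mh].
  rewrite [X in measurable_fun _ X](_ : _ = cst 0)//.
  by apply/funext => w; rewrite big_geq.
rewrite [X in measurable_fun _ X](_ : _ =
  fun w => \sum_(1 <= s < n.+1) h s w + h n.+1 w); last first.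
  by apply/funext => w; rewrite big_nat_recr.
apply: measurable_funD; last by apply: mh; rewrite ltnS leqnn.
by apply: ih => s /andP[s1 sn]; apply: mh; rewrite s1 (ltn_trans sn).
Qed.

Lemma measurable_ecdf n b :
  (forall s, (1 <= s < n.+1)%N -> measurable_fun setT (M s)) ->
  measurable_fun setT (fun w => ecdf (M ^~ w) n b).
Proof.
move=> mM; apply: measurable_funM => //; apply: measurable_bigsum_nat => s sn.
by apply/measurable_nat_of_bool/measurable_fun_ltr => //; exact: mM.
Qed.

(** On positive values the inverse is [expR (- ln (h w))], and at 0 it is 0 by convention. *)
Lemma measurable_invr_ge0 (h : T -> R) : (forall w, 0 <= h w) ->
  measurable_fun setT h -> measurable_fun setT (fun w => (h w)^-1).
Proof.
move=> h0 mh; rewrite (_ : (fun _ => _) =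
    fun w => if 0 < h w then expR (- ln (h w)) else 0); last first.
  apply/funext => w; case: ltP => [hw|hw]; first by rewrite expRN lnK.
  by have /eqP -> : h w == 0; rewrite ?invr0// eq_le hw h0.
apply: measurable_fun_ifT => //; first exact: measurable_fun_ltr.
apply: measurableT_comp; first exact: measurable_expR.
by apply: measurableT_comp => //; apply: measurableT_comp => //; exact: measurable_ln.
Qed.

Lemma measurable_sqrtr (h : T -> R) :
  measurable_fun setT h -> measurable_fun setT (fun w => Num.sqrt (h w)).
Proof.
move=> mh; apply: measurableT_comp => //.
by apply: nondecreasing_measurable => // x y xy; exact: ler_wsqrtr.
Qed.

Lemma wins_ge0 gamma vs ms n : 0 <= wins gamma vs ms n.
Proof. by rewrite sumr_ge0// => s _; case/andP: (win_01 gamma vs ms s). Qed.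

(** The hypotheses stop before round [t] and [T] is arbitrary: taking for [T] the sigma-algebra of
    the past shows that bids are predictable. *)
Lemma measurable_ucbid_bid gamma t : (1 <= t)%N ->
  (forall s, (1 <= s < t)%N -> measurable_fun setT (V s)) ->
  (forall s, (1 <= s < t)%N -> measurable_fun setT (M s)) ->
  measurable_fun setT (fun w => ucbid_bid gamma (V ^~ w) (M ^~ w) t).
Proof.
elim/ltn_ind: t => -[//|[|n]] ih _ mV mM.
  by rewrite (_ : (fun _ => _) = cst 1)//; apply/funext => w; rewrite ucbid_bid1.
have mwin s : (1 <= s < n.+2)%N ->
    measurable_fun setT (fun w => win gamma (V ^~ w) (M ^~ w) s).
  move=> /andP[s1 sn]; apply/measurable_nat_of_bool/measurable_fun_ler.
    by apply: mM; rewrite s1.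
  by apply: ih => // r /andP[r1 rs]; [apply: mV|apply: mM];
    rewrite r1 (leq_trans rs)// ltnW.
have mwins : measurable_fun setT (fun w => wins gamma (V ^~ w) (M ^~ w) n.+1).
  exact: measurable_bigsum_nat.
have mucb : measurable_fun setT (fun w => ucb gamma (V ^~ w) (M ^~ w) n.+1).
  apply: measurable_funD.
    apply: measurable_funM.
      apply: measurable_bigsum_nat => s sn; apply: measurable_funM; first exact: mV.
      exact: mwin.
    by apply: measurable_invr_ge0 => // w; exact: wins_ge0.
  apply: measurable_sqrtr; apply: measurable_funM => //.
  apply: measurable_invr_ge0; last exact: measurable_funM.
  by move=> w; rewrite mulr_ge0// wins_ge0.
under eq_fun do rewrite ucbid_bidS//.
apply: (measurable_max_argmax_bid (K := fun w => `|ucb gamma (V ^~ w) (M ^~ w) n.+1|)).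
- move=> b; apply: measurable_funM; first exact: measurable_funB.
  exact: measurable_ecdf.
- by move=> w b; exact: score_le.
- by move=> w b; exact: score_left.
Qed.

(** The hypotheses include round [s] for [M] but stop before it for [V]: a win is decided before its
    value is seen, which makes it an admissible switch for a factor carrying [V s]. *)
Lemma measurable_win gamma s : (1 <= s)%N ->
  (forall r, (1 <= r < s)%N -> measurable_fun setT (V r)) ->
  (forall r, (1 <= r <= s)%N -> measurable_fun setT (M r)) ->
  measurable_fun setT (fun w => win gamma (V ^~ w) (M ^~ w) s).
Proof.
move=> s1 mV mM; apply/measurable_nat_of_bool/measurable_fun_ler.
  by apply: mM; rewrite s1 leqnn.
apply: measurable_ucbid_bid => // r /andP[r1 rs].
by apply: mM; rewrite r1 ltnW.
Qed.

End measurability.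
End ucbid_bids.

(** * Elementary inequalities for exponentials and derivatives *)

Lemma ge0_deriv_ge0 (R : realType) (h dh : R -> R) :
  h 0 = 0 -> (forall x, is_derive x (1 : R) h (dh x)) ->
  (forall x, 0 <= x -> 0 <= dh x) -> forall x, 0 <= x -> 0 <= h x.
Proof.
move=> h00 hd dh0 x; rewrite le_eqVlt => /predU1P[<-|x0]; first by rewrite h00.
have hc : {within `[0, x], continuous h}.
  by apply: derivable_within_continuous => y _; have := hd y.
have [c /itvP c0x] := MVT x0 (fun y _ => hd y) hc.
by rewrite h00 !subr0 => ->; rewrite mulr_ge0// ?dh0// ?c0x// ltW.
Qed.

(** Hoeffding's lemma for a Bernoulli variable: [h], the difference of the logarithms, vanishes at 0
    together with its derivative [k], whose own derivative is nonnegative. *)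
Lemma bernoulli_mgf_le_ge0 (R : realType) (p l : R) : 0 <= p <= 1 -> 0 <= l ->
  1 - p + p * expR l <= expR (l * p + l ^+ 2 / 8).
Proof.
move=> /andP[p0 p1] l0.
pose q x : R := 1 - p + p * expR x.
have q0 x : 0 < q x by have := expR_gt0 x; rewrite /q; nra.
have qd x : is_derive x (1 : R) q (p * expR x).
  rewrite /q; apply: is_derive_eq.
  by rewrite add0r mul1r.
have qn0 x : q x != 0 by rewrite gt_eqF.
pose k x : R := p + x / 4 - p * expR x * (q x)^-1.
have k0 x : 0 <= x -> 0 <= k x.
  apply: (@ge0_deriv_ge0 _ k
    (fun x => 4^-1 - p * (1 - p) * expR x / q x ^+ 2)).
  - by rewrite /k /q expR0 mul0r addr0 mulr1 subrK invr1 mulr1 subrr.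
  - move=> y; have qV := @is_deriveV _ q y (p * expR y) 1 (qn0 y) (qd y).
    rewrite /k; apply: is_derive_eq; rewrite /GRing.scale/=.
    by rewrite /q; field; exact: qn0.
  (* The variance of the tilted Bernoulli variable is at most 1/4, by the inequality of arithmetic
     and geometric means. *)
  - move=> y _; rewrite subr_ge0 ler_pdivrMr ?exprn_gt0//.
    by have := sqr_ge0 (1 - p - p * expR y); rewrite /q; nra.
pose h x : R := p * x + x ^+ 2 / 8 - ln (q x).
have h00 : h 0 = 0.
  by rewrite /h /q expR0 mulr1 subrK ln1 mulr0 expr0n/= mul0r addr0 subr0.
have hd y : is_derive y (1 : R) h (k y).
  have lq := is_derive1_comp (is_derive1_ln (q0 y)) (qd y).
  rewrite /h; apply: is_derive_eq; rewrite /GRing.scale/= /k.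
  by field; exact: qn0.
have h0 : 0 <= h l by exact: (ge0_deriv_ge0 h00 hd k0 l0).
rewrite -[leLHS]/(q l) -[leLHS]lnK ?posrE// ler_expR.
by move: h0; rewrite /h; lra.
Qed.

(** A negative [l] is handled by exchanging success and failure, that is, [p] with [1 - p] and [l]
    with [- l]. *)
Lemma bernoulli_mgf_le (R : realType) (p l : R) : 0 <= p <= 1 ->
  1 - p + p * expR l <= expR (l * p + l ^+ 2 / 8).
Proof.
move=> p01; have [l0|l0] := leP 0 l; first exact: bernoulli_mgf_le_ge0.
have := @bernoulli_mgf_le_ge0 _ (1 - p) (- l).
rewrite sqrrN => /(_ ltac:(lra) ltac:(lra)) h.
have -> : l * p + l ^+ 2 / 8 = l + (- l * (1 - p) + l ^+ 2 / 8) by ring.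
rewrite expRD; apply: le_trans (ler_wpM2l (expR_ge0 l) h).
rewrite mulrDr mulrCA -expRD subrr expR0; lra.
Qed.

(** Squaring [1 - x / 2 <= expR (- x / 2)] bounds [expR x] by [1 / (1 - x / 2) ^+ 2]; what remains
    is a polynomial inequality. *)
Lemma expR_le_quad (R : realType) (x : R) : x <= 1 -> expR x <= 1 + x + 2 * x ^+ 2.
Proof.
move=> x1.
have h : 1 - x / 2 <= expR (- x / 2) by have := expR_ge1Dx (- x / 2); lra.
have h2 : (1 - x / 2) ^+ 2 <= expR (- x).
  rewrite (_ : - x = - x / 2 *+ 2); last by rewrite mulr2n; field.
  rewrite -[X in expR X]mulr_natl expRM_natl ler_sqr// nnegrE; first by lra.
  exact: expR_ge0.
rewrite -[x in expR x]opprK expRN -div1r ler_pdivrMr ?expR_gt0//.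
apply: (@le_trans _ _ ((1 + x + 2 * x ^+ 2) * (1 - x / 2) ^+ 2)).
  rewrite -subr_ge0 (_ : _ - _ = x ^+ 2 / 2 * ((x - 1) * (x - 5 / 2))); last by field.
  by rewrite mulr_ge0 ?divr_ge0 ?sqr_ge0//; nra.
by rewrite ler_wpM2l//; nra.
Qed.

(** The bound is [(1 - x) / (1 - x / 2) ^+ 2] in another form, from the same squared inequality. It
    is the source of the quadratic loss. *)
Lemma tangent_gap (R : realType) (x : R) : x <= 1 ->
  (1 - x) * expR x <= 1 - (x / 2) ^+ 2 / (1 - x / 2) ^+ 2.
Proof.
move=> x1.
have h : 1 - x / 2 <= expR (- x / 2) by have := expR_ge1Dx (- x / 2); lra.
have h2 : (1 - x / 2) ^+ 2 <= expR (- x).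
  rewrite (_ : - x = - x / 2 *+ 2); last by rewrite mulr2n; field.
  rewrite -[X in expR X]mulr_natl expRM_natl ler_sqr// nnegrE; first by lra.
  exact: expR_ge0.
have s0 : 0 < (1 - x / 2) ^+ 2 by rewrite exprn_gt0//; lra.
rewrite (_ : 1 - _ / _ = (1 - x) / (1 - x / 2) ^+ 2); last first.
  by field; apply/eqP; lra.
rewrite -[x in expR x]opprK expRN ler_wpM2l ?subr_ge0// lef_pV2// posrE.
exact: expR_gt0.
Qed.

Lemma is_derive_linear_approx (R : realType) (f : R -> R) (x l : R) :
  is_derive x (1 : R) f l -> forall e, 0 < e -> exists2 dl : R, 0 < dl &
    forall y, `|y - x| < dl -> `|f y - f x - l * (y - x)| <= e * `|y - x|.
Proof.
move=> [dfx lE] e e0.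
have : (fun h : R => h^-1 *: (f (h *: (1 : R) + x) - f x)) @ 0^' --> l.
  by rewrite -lE; exact: dfx.
move=> /cvgrPdist_le /(_ e e0) /nbhs_ballP [dl /= dl0 H].
exists dl => // y yx; have [->|yNx] := eqVneq y x.
  by rewrite !subrr mulr0 subr0 normr0 mulr0.
have yx0 : y - x != 0 by rewrite subr_eq0.
have := H (y - x); rewrite /ball/= sub0r normrN => /(_ yx yx0).
rewrite /GRing.scale/= mulr1 subrK => le.
have -> : f y - f x - l * (y - x) = - (l - (y - x)^-1 * (f y - f x)) * (y - x).
  by field.
by rewrite normrM normrN ler_wpM2r.
Qed.

Lemma is_derive_lipschitz_at (R : realType) (f : R -> R) (x l : R) :
  is_derive x (1 : R) f l -> exists2 dl : R, 0 < dl &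
    forall y, `|y - x| < dl -> `|f y - f x| <= (1 + `|l|) * `|y - x|.
Proof.
move=> /is_derive_linear_approx /(_ 1 ltr01) [dl dl0 H]; exists dl => // y yx.
rewrite -[X in `|X|](subrK (l * (y - x))) (le_trans (ler_normD _ _))//.
by rewrite normrM mulrDl lerD2r; exact: H.
Qed.

(** * The quadratic utility gap *)

Section utility_analysis.
Context {R : realType}.
Variables (F f G : R -> R) (v bstar Delta Cf : R).
Hypothesis Fmono : forall x y : R, x <= y -> F x <= F y.
Hypothesis F_ge0 : forall x, 0 <= F x.
Hypothesis F_le1 : forall x, F x <= 1.
Hypothesis F_neg : forall x : R, x < 0 -> F x = 0.
Hypothesis dF : forall x : R, 0 < x < 1 -> is_derive x (1 : R) F (f x).
Hypothesis logconcave : forall x y : R, 0 < x -> x < y -> y < 1 -> f y / F y < f x / F x.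
Hypothesis v01 : 0 <= v <= 1.
Hypothesis bstar01 : 0 <= bstar <= 1.
Hypothesis bstar_max : forall b : R, 0 <= b <= 1 -> util v F b <= util v F bstar.
Hypothesis Delta0 : 0 < Delta.
Hypothesis f_lt : forall b : R, bstar - Delta <= b <= bstar + Delta -> f b < Cf.
Hypothesis dphi : exists D, is_derive bstar (1 : R) (fun x : R => x + F x / f x) D.
Hypothesis Fbstar : 0 < F bstar.

Lemma density_ge0 (x : R) : 0 < x < 1 -> 0 <= f x.
Proof.
move=> x01; rewrite leNgt; apply/negP => fx0.
have e0 : 0 < - f x / 2 by lra.
have [dl dl0 H] := is_derive_linear_approx (dF x01) e0.
have := H (x + dl / 2); rewrite addrAC subrr add0r gtr0_norm; last by lra.
have := Fmono (x := x) (y := x + dl / 2) ltac:(lra).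
move=> FF /(_ ltac:(lra)); rewrite ler_norml => /andP[_]; nra.
Qed.

(** The ratio [f / F] at [x] strictly exceeds its nonnegative value at a later point; with [F x = 0]
    it would be 0, since division by 0 gives 0. *)
Lemma density_cdf_gt0 (x : R) : 0 < x < 1 -> 0 < f x /\ 0 < F x.
Proof.
move=> x01.
have y01 : 0 < (x + 1) / 2 < 1 by lra.
have fF : 0 < f x / F x.
  apply: le_lt_trans (_ : f ((x + 1) / 2) / F ((x + 1) / 2) < _).
    by rewrite divr_ge0// density_ge0.
  by apply: logconcave; lra.
have Fx : 0 < F x.
  rewrite lt_neqAle F_ge0 andbT eq_sym; apply/eqP => F0.
  by rewrite F0 invr0 mulr0 ltxx in fF.
by split => //; move: fF; rewrite pmulr_lgt0// invr_gt0.
Qed.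

(* At [bstar = 0], continuity of [b + F b / f b], which equals [b] for [b < 0],
   would make [F b / f b] tend to [0] as [b] decreases to [0], against [f < Cf]
   and [F 0 > 0]. *)
Lemma bstar_gt0 : 0 < bstar.
Proof.
have [//|b0] := ltP 0 bstar; have {}b0 : bstar = 0 by case/andP: bstar01; lra.
have [D /is_derive_lipschitz_at [dl dl0]] := dphi; rewrite b0.
set L := 1 + `|D|; have L1 : 1 <= L by rewrite lerDl.
pose m := Num.min dl (Num.min Delta 1).
have m0 : 0 < m by rewrite !lt_min dl0 Delta0 ltr01.
have [md mD m1] : [/\ m <= dl, m <= Delta & m <= 1].
  by split; rewrite /m !ge_min lexx ?orbT.
have Cf0 : 0 < Cf.
  have [|fx _] := @density_cdf_gt0 (m / 2); first by lra.
  by apply: lt_trans fx (f_lt _); rewrite b0; lra.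
(* Small enough that [F 0 / Cf], a lower bound for [F s / f s], exceeds the variation [2 * L * s]
   allowed between [- s] and [s]. *)
pose s := Num.min (m / 2) (F 0 / Cf / (3 * L)).
have F00 : 0 < F 0 by have := Fbstar; rewrite b0.
have s0 : 0 < s by rewrite lt_min !divr_gt0 ?mulr_gt0//; lra.
have sm : s <= m / 2 by rewrite ge_min lexx.
have : s <= F 0 / Cf / (3 * L) by rewrite ge_min lexx orbT.
rewrite ler_pdivlMr; last by lra.
move=> sc H.
have := H s; have := H (- s); rewrite !subr0 normrN gtr0_norm//.
move=> /(_ ltac:(lra)) H1 /(_ ltac:(lra)) H2.
rewrite (F_neg (x := - s)) in H1; last by lra.
have [fs Fs] := @density_cdf_gt0 s ltac:(lra).
have fsC : f s < Cf by apply: f_lt; rewrite b0; lra.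
have : F 0 / Cf <= F s / f s.
  rewrite ler_pdivrMr// mulrAC ler_pdivlMr//.
  have := Fmono (x := 0) (y := s) ltac:(lra); nra.
move: H1 H2; rewrite !ler_norml mul0r addr0 add0r => /andP[? ?] /andP[? ?].
nra.
Qed.

(** If [v = 0], the bid 0 has utility 0 while [bstar] has negative utility. *)
Lemma v_gt0 : 0 < v.
Proof.
have /andP[v0 v1] := v01; rewrite lt_neqAle v0 andbT eq_sym; apply/eqP => v00.
have := @bstar_max 0; rewrite /util v00 subrr mul0r => /(_ ltac:(lra)).
have := bstar_gt0; have := Fbstar; nra.
Qed.

(** Otherwise [bstar] has utility at most 0, whereas [v / 2] has positive utility. *)
Lemma bstar_lt_v : bstar < v.
Proof.
rewrite ltNge; apply/negP => vb; have v0 := v_gt0; have /andP[_ v1] := v01; have Fb := Fbstar.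
have [_ Fv] := @density_cdf_gt0 (v / 2) ltac:(lra).
have := @bstar_max (v / 2) ltac:(lra); rewrite /util; nra.
Qed.

Lemma bstar_oo01 : 0 < bstar < 1.
Proof. by rewrite bstar_gt0 (lt_le_trans bstar_lt_v)//; case/andP: v01. Qed.

Lemma util_bstar_gt0 : 0 < util v F bstar.
Proof. by rewrite /util mulr_gt0// subr_gt0 bstar_lt_v. Qed.

(** Fermat's rule at an interior maximizer; it identifies the slope of [ln F] at [bstar] as
    [1 / (v - bstar)]. *)
Lemma first_order_condition : f bstar * (v - bstar) = F bstar.
Proof.
have dU (x : R) : 0 < x < 1 -> is_derive x (1 : R) (util v F) ((v - x) * f x - F x).
  move=> x01; have dFx := dF x01.
  have : is_derive x (1 : R) (fun x => (v - x) * F x) ((v - x) * f x - F x).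
    by apply: is_derive_eq; rewrite /GRing.scale/=; ring.
  exact.
have b01 := bstar_oo01.
have h1 : is_derive bstar (1 : R) (util v F) 0.
  apply: (@derive1_at_max _ _ 0 1) => //.
  - by move=> t; rewrite in_itv/= => t01; have := dU _ t01.
  - by move=> t; rewrite in_itv/= => t01; apply: bstar_max; lra.
have := @derive_val _ _ _ _ _ _ _ h1; rewrite (@derive_val _ _ _ _ _ _ _ (dU _ b01)).
lra.
Qed.

(** The derivative of [F x * expR (- (r * x))] has the sign of [f / F - r], which is decreasing and
    vanishes at [bstar]; the product is therefore maximal there. *)
Lemma cdf_tangent (b : R) : 0 < b < 1 -> F b <= F bstar * expR ((b - bstar) / (v - bstar)).
Proof.
move=> b01; set r := (v - bstar)^-1.
have bs01 := bstar_oo01; have bv := bstar_lt_v.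
have rE : r = f bstar / F bstar.
  by rewrite /r -first_order_condition; field; apply/andP; split; apply/eqP;
    have [] := density_cdf_gt0 bs01; lra.
pose h x := F x * expR (- (r * x)).
have dh (x : R) : 0 < x < 1 -> is_derive x (1 : R) h ((f x - r * F x) * expR (- (r * x))).
  move=> x01; have dFx := dF x01; rewrite /h.
  by apply: is_derive_eq; rewrite /GRing.scale/=; ring.
have hc (x y : R) : 0 < x -> y < 1 -> {within `[x, y], continuous h}.
  move=> x0 y1; apply: derivable_within_continuous => z; rewrite in_itv/= => zxy.
  by have := dh z ltac:(lra).
have mvt (x y : R) : 0 < x -> x < y -> y < 1 -> exists2 c, x < c < y &
    h y - h x = (f c - r * F c) * expR (- (r * c)) * (y - x).
  move=> x0 xy y1.
  have dxy z : z \in `]x, y[ -> is_derive z (1 : R) h ((f z - r * F z) * expR (- (r * z))).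
    by rewrite in_itv/= => /andP[xz zy]; apply: dh; rewrite (lt_trans x0)// (lt_trans zy).
  by have [c] := MVT xy dxy (hc _ _ x0 y1); rewrite in_itv/=; exists c.
suff : h b <= h bstar.
  rewrite /h => hb; have := ler_wpM2r (expR_ge0 (r * b)) hb.
  rewrite -!mulrA -!expRD addNr expR0 mulr1 => /le_trans; apply.
  by rewrite le_eqVlt; apply/orP; left; apply/eqP; congr (_ * expR _); ring.
have [bb|bb|->//] := ltgtP b bstar.
- have [c cb E] := mvt b bstar ltac:(lra) bb ltac:(lra); rewrite -subr_ge0 E.
  have [_ Fc] := @density_cdf_gt0 c ltac:(lra).
  have := @logconcave c bstar ltac:(lra) ltac:(lra) ltac:(lra).
  rewrite -rE ltr_pdivlMr// => ?.
  by apply: mulr_ge0; [apply: mulr_ge0; rewrite ?expR_ge0//|]; lra.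
- have [c cb E] := mvt bstar b ltac:(lra) bb ltac:(lra); rewrite -subr_le0 E.
  have [_ Fc] := @density_cdf_gt0 c ltac:(lra).
  have := @logconcave bstar c ltac:(lra) ltac:(lra) ltac:(lra).
  rewrite -rE ltr_pdivrMr// => ?.
  by apply: mulr_le0_ge0; [apply: mulr_le0_ge0; rewrite ?expR_ge0//|]; lra.
Qed.

Hypothesis G_le : forall b, G b <= F b.
Hypothesis G_ge0 : forall b, 0 <= G b.
Hypothesis G_neg : forall b : R, b <= 0 -> G b = 0.
Hypothesis G_in : forall b : R, 0 < b < 1 -> G b = F b.

(* The tangent [F b <= F bstar * expR x], [x := (b - bstar) / (v - bstar)], turns
   the utility into [U bstar * ((1 - x) * expR x)]. *)
Lemma utility_gap (b : R) : 0 <= b <= 1 ->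
  util v F bstar / 4 * (b - bstar) ^+ 2 <= util v F bstar - (v - b) * G b.
Proof.
move=> b01; have U0 := util_bstar_gt0; have bv := bstar_lt_v.
have bs := bstar_gt0; have v1 : v <= 1 by case/andP: v01.
have sq1 : (b - bstar) ^+ 2 <= 1 by nra.
(* A bid with nonpositive utility loses at least [util v F bstar], and [(b - bstar) ^+ 2 <= 1]. *)
have easy : (v - b) * G b <= 0 ->
    util v F bstar / 4 * (b - bstar) ^+ 2 <= util v F bstar - (v - b) * G b.
  by move=> le0; nra.
have [vb|bv'] := leP v b; first by apply: easy; have := G_ge0 b; nra.
have [b0|b0] := leP b 0; first by apply: easy; rewrite G_neg// mulr0.
pose x := (b - bstar) / (v - bstar).
have x1 : x <= 1 by rewrite ler_pdivrMr; lra.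
have Ub : (v - b) * G b <= util v F bstar * ((1 - x) * expR x).
  rewrite G_in; last by lra.
  have -> : util v F bstar * ((1 - x) * expR x) = (v - b) * (F bstar * expR x).
    by rewrite /util /x; field; apply/eqP; lra.
  by rewrite ler_wpM2l ?cdf_tangent//; lra.
have := ler_wpM2l (ltW U0) (tangent_gap x1).
(* In terms of [b], the denominator is the square of [v - bstar / 2 - b / 2], which lies between 0
   and 1; this produces the factor 1/4. *)
have : (b - bstar) ^+ 2 / 4 <= (x / 2) ^+ 2 / (1 - x / 2) ^+ 2.
  have -> : (x / 2) ^+ 2 / (1 - x / 2) ^+ 2 =
      (b - bstar) ^+ 2 / 4 / ((v - bstar / 2 - b / 2) ^+ 2).
    by rewrite /x; field; apply/andP; split; apply/eqP; lra.
  rewrite ler_pdivlMr; last by rewrite exprn_gt0//; lra.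
  rewrite -[leRHS]mulr1 ler_wpM2l//; first by rewrite divr_ge0// sqr_ge0.
  by rewrite expr_le1//; lra.
move: ((x / 2) ^+ 2 / _) => z; nra.
Qed.

(** Differentiability gives the bound near [bstar]; at distance at least [m], the trivial bound 1 is
    at most [m^-1] times the distance. *)
Lemma G_lipschitz_at : exists2 L : R, 1 <= L &
  forall b, 0 <= b <= 1 -> `|G b - G bstar| <= L * `|b - bstar|.
Proof.
have bs := bstar_oo01.
have [dl dl0 H] := is_derive_lipschitz_at (dF bs).
pose m := Num.min dl (Num.min bstar (1 - bstar)).
have m0 : 0 < m by rewrite !lt_min dl0; lra.
have [md mb m1] : [/\ m <= dl, m <= bstar & m <= 1 - bstar].
  by split; rewrite /m !ge_min lexx ?orbT.
exists (1 + `|f bstar| + m^-1).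
  have : 0 < m^-1 by rewrite invr_gt0.
  have := normr_ge0 (f bstar); lra.
move=> b b01; have [bm|mb'] := ltP `|b - bstar| m.
  rewrite !G_in//; last by move: bm; rewrite ltr_norml; lra.
  apply: le_trans (H b _) _; first by lra.
  by rewrite ler_wpM2r// lerDl invr_ge0 ltW.
apply: (@le_trans _ _ 1).
  have := G_ge0 b; have := G_le b; have := F_le1 b.
  have := G_ge0 bstar; have := G_le bstar; have := F_le1 bstar.
  by rewrite ler_norml; lra.
have : 1 <= m^-1 * `|b - bstar| by rewrite mulrC ler_pdivlMr// mul1r.
have := normr_ge0 (f bstar); have := normr_ge0 (b - bstar); nra.
Qed.

(** The mean value theorem with [f < Cf]. Here both points vary, as is needed to pass from a grid
    point to the actual bid. *)
Lemma cdf_lipschitz_near : exists2 dl : R, 0 < dl & exists2 L : R, 0 <= L &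
  [/\ dl <= bstar, dl <= 1 - bstar & forall b b' : R,
    `|b - bstar| < dl -> `|b' - bstar| < dl -> `|F b - F b'| <= L * `|b - b'|].
Proof.
have bs := bstar_oo01.
pose m := Num.min Delta (Num.min bstar (1 - bstar)).
have m0 : 0 < m by rewrite !lt_min Delta0; lra.
have [mD mb m1] : [/\ m <= Delta, m <= bstar & m <= 1 - bstar].
  by split; rewrite /m !ge_min lexx ?orbT.
have Cf0 : 0 <= Cf.
  have [fb _] := density_cdf_gt0 bs.
  by apply: le_trans (ltW fb) (ltW (f_lt _)); lra.
exists m => //; exists Cf => //; split => //.
have main (b b' : R) : `|b - bstar| < m -> `|b' - bstar| < m -> b < b' ->
    `|F b - F b'| <= Cf * `|b - b'|.
  rewrite !ltr_norml => bm b'm bb'.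
  have Fc : {within `[b, b'], continuous F}.
    apply: derivable_within_continuous => z; rewrite in_itv/= => zb.
    by have := dF (x := z) ltac:(lra).
  have [c] := MVT bb' (fun x xb => dF (x := x) ltac:(move: xb; rewrite in_itv/=; lra)) Fc.
  rewrite in_itv/= => cb E; rewrite distrC E distrC normrM ler_wpM2r//.
  have [fc _] := @density_cdf_gt0 c ltac:(lra).
  by rewrite gtr0_norm// ltW// f_lt//; lra.
move=> b b' bm b'm; have [bb|bb|->] := ltgtP b b'.
- exact: main.
- by rewrite distrC [`|b - b'|]distrC; exact: main.
- by rewrite !subrr normr0 mulr0.
Qed.

End utility_analysis.

(** * Chernoff bounds in exponential form *)

Section chernoff_bounds.
Context {R : realType}.
Implicit Types (m L x : R).

(* Up to a constant, the optimal exponent in the Chernoff bound for a sum of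
   Bernoulli variables with mean [m] at confidence level [expR (- L)]. *)
Definition chernoff_rate m L : R := if m <= L then 1 else Num.sqrt (m * L) / m.

(** Both tails at level [expR (- L)]: for a sum of independent Bernoulli variables of total mean
    [m], [2 * m * mu ^+ 2] dominates the logarithm of the centred moment generating function, so
    each term has expectation at most [expR (- L)]. *)
Definition chernoff_weight m L x : R := let mu := chernoff_rate m L in
  expR (mu * (x - m) - 2 * m * mu ^+ 2 - L) +
  expR (- mu * (x - m) - 2 * m * mu ^+ 2 - L).

Lemma chernoff_rate_01 m L : 0 <= L -> 0 <= chernoff_rate m L <= 1.
Proof.
move=> L0; rewrite /chernoff_rate; have [_|Lm] := leP m L; first by rewrite ler01 lexx.
have m0 : 0 < m by lra.
rewrite divr_ge0 ?sqrtr_ge0 ?(ltW m0)//= ler_pdivrMr// mul1r.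
rewrite -[leRHS](ger0_norm (ltW m0)) -sqrtr_sqr ler_wsqrtr// expr2.
by rewrite ler_wpM2l// ltW.
Qed.

(** Both exponents are negative. If [m <= L], the deviation is below [2 * m + L], and [m] is at most
    the square root of [m * L]; otherwise [2 * m * mu ^+ 2 = 2 * L], so [mu] times the deviation is
    below [3 * L]. *)
Lemma chernoff_lt1 m L x : 0 <= m -> 0 <= L -> chernoff_weight m L x < 1 ->
  `|x - m| <= 3 * Num.sqrt (m * L) + L.
Proof.
move=> m0 L0; rewrite /chernoff_weight; set mu := chernoff_rate m L => lt1.
have e1 : mu * (x - m) - 2 * m * mu ^+ 2 - L < 0.
  by rewrite -expR_lt1; have := expR_gt0 (- mu * (x - m) - 2 * m * mu ^+ 2 - L); lra.
have e2 : - mu * (x - m) - 2 * m * mu ^+ 2 - L < 0.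
  by rewrite -expR_lt1; have := expR_gt0 (mu * (x - m) - 2 * m * mu ^+ 2 - L); lra.
move: e1 e2; rewrite /mu /chernoff_rate; have [mL|Lm] := leP m L.
  rewrite mul1r expr1n mulN1r => e1 e2.
  have : m <= Num.sqrt (m * L).
    by rewrite -[leLHS](ger0_norm m0) -sqrtr_sqr ler_wsqrtr// expr2 ler_wpM2l.
  by rewrite ler_norml; lra.
have {}m0 : 0 < m by lra.
have s0 := sqrtr_ge0 (m * L).
have sE : Num.sqrt (m * L) ^+ 2 = m * L by rewrite sqr_sqrtr// mulr_ge0// ltW.
move: (Num.sqrt _) s0 sE => s s0 sE.
have -> : 2 * m * (s / m) ^+ 2 = 2 * L.
  by rewrite expr_div_n sE; field; rewrite gt_eqF.
move=> e1 e2.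
have h1 : s * (x - m) < 3 * (L * m).
  have : s / m * (x - m) < 3 * L by lra.
  by rewrite mulrAC ltr_pdivrMr// mulrA.
have h2 : - (s * (x - m)) < 3 * (L * m).
  have : - (s / m * (x - m)) < 3 * L by lra.
  by rewrite mulrAC -mulNr ltr_pdivrMr// mulrA.
have {}s0 : 0 < s.
  by rewrite lt_neqAle s0 andbT eq_sym; apply/eqP => s00; move: h1 h2 sE; rewrite s00; nra.
rewrite ler_norml; apply/andP; split; nra.
Qed.

(** Convexity, by averaging with weights [1 - y] and [y] the tangent inequalities at [l * y]
    evaluated at 0 and at [l]. *)
Lemma expR_convex01 (l y : R) : 0 <= y <= 1 -> expR (l * y) <= 1 - y + y * expR l.
Proof.
move=> y01.
have h0 := expR_ge1Dx (- (l * y)); have h1 := expR_ge1Dx (l - l * y).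
have p0 := expR_gt0 (l * y).
have e0 : expR (l * y) * expR (- (l * y)) = 1 by rewrite -expRD subrr expR0.
have e1 : expR (l * y) * expR (l - l * y) = expR l.
  by rewrite -expRD addrC subrK.
have h0' : expR (l * y) * (1 - l * y) <= 1.
  by rewrite -[leRHS]e0 ler_wpM2l// ltW.
have h1' : expR (l * y) * (1 + (l - l * y)) <= expR l.
  by rewrite -[leRHS]e1 ler_wpM2l// ltW.
move: (expR (l * y)) (expR l) h0' h1' => a c h0' h1'; nra.
Qed.

(** This turns a quadratic gap into a distance of order [y]: beyond the claimed bound, [A * (x * y)]
    is at most half of [K * x ^+ 2] and, as [K <= A], [A * y ^+ 2] is at most a quarter of it. *)
Lemma quadratic_bound (K A x y : R) : 0 < K -> K <= A -> 0 <= x -> 0 < y ->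
  K * x ^+ 2 <= A * (x * y + y ^+ 2) -> x <= 2 * A / K * y.
Proof.
move=> K0 KA x0 y0 H; rewrite leNgt mulrAC ltr_pdivrMr//; apply/negP => lt.
have h1 : A * (x * y) <= x ^+ 2 * K / 2 by nra.
have h2 : A * y ^+ 2 <= x ^+ 2 * K / 4.
  have xy : y <= x / 2 by nra.
  have := ler_wpM2r (ltW y0) (ltW lt).
  have := ler_wpM2l (mulr_ge0 x0 (ltW K0)) xy.
  lra.
have x00 : 0 < x by nra.
by nra.
Qed.

End chernoff_bounds.

(** * Powers against logarithms, and a power sum *)

Section rates.
Context {R : realType}.

Lemma powR_eventually_ge (e K : R) : 0 < e ->
  exists n0 : nat, forall n, (n0 <= n)%N -> K <= n%:R `^ e.
Proof.
move=> e0; pose K' := Num.max 0 K `^ e^-1.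
exists (Num.truncn K').+1 => n n0.
have K'n : K' <= n%:R.
  apply: (@le_trans _ _ (Num.truncn K').+1%:R); last by rewrite ler_nat.
  by apply/ltW/truncnS_gt.
apply: (@le_trans _ _ (K' `^ e)).
  rewrite -powRrM mulVf ?gt_eqF// powRr1 ?le_max ?lexx ?orbT//.
by apply: ge0_ler_powR; rewrite ?nnegrE ?powR_ge0// ltW.
Qed.

(** With [z = n ^ (e / 2)], [ln z <= z] reads [2 * ln n <= 4 / e * z], and eventually
    [4 / e <= z]. *)
Lemma ln_eventually_le_powR (e : R) : 0 < e ->
  exists n0 : nat, forall n, (n0 <= n)%N -> 2 * ln n%:R <= n%:R `^ e :> R.
Proof.
move=> e0; have e20 : 0 < e / 2 by lra.
have [n0 H] := powR_eventually_ge (4 / e) e20.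
exists n0.+1 => n nn0; have n0' : 0 < n%:R :> R by rewrite ltr0n (leq_trans _ nn0).
have h : 4 / e <= n%:R `^ (e / 2) by apply: H; exact: ltnW.
have -> : n%:R `^ e = n%:R `^ (e / 2) * n%:R `^ (e / 2) :> R.
  by rewrite -powRD -?splitr// gt_eqF//; apply/implyP.
have p0 : 0 < n%:R `^ (e / 2) :> R by rewrite powR_gt0.
have : ln (n%:R `^ (e / 2)) <= n%:R `^ (e / 2) :> R.
  have := le_ln1Dx (x := n%:R `^ (e / 2) - 1); rewrite addrCA subrr addr0.
  by move=> /(_ ltac:(lra)); lra.
rewrite ln_powR => le; apply: le_trans (ler_wpM2r (ltW p0) h).
rewrite mulrAC ler_pdivlMr//; lra.
Qed.

(** Telescoping: for consecutive cube roots [a <= b], factoring [b ^+ 3 - a ^+ 3 = 1] gives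
    [1 / b ^+ 2 <= 3 * (b - a)]. *)
Lemma sum_powR_third (n : nat) :
  \sum_(1 <= m < n.+1) m%:R `^ (- (2 / 3)) <= 3 * n%:R `^ 3^-1 :> R.
Proof.
elim: n => [|n ih]; first by rewrite big_geq// mulr_ge0// powR_ge0.
rewrite big_nat_recr//=; apply: le_trans (lerD ih (lexx _)) _.
set a := n%:R `^ 3^-1; set b : R := n.+1%:R `^ 3^-1.
have a0 : 0 <= a by exact: powR_ge0.
have b0 : 0 < b by rewrite powR_gt0.
have aE : a ^+ 3 = n%:R by rewrite /a -powR_mulrn ?powR_ge0// -powRrM mulVf ?powRr1.
have bE : b ^+ 3 = n%:R + 1.
  by rewrite /b -powR_mulrn ?powR_ge0// -powRrM mulVf ?powRr1// natr1.
have -> : n.+1%:R `^ (- (2 / 3)) = (b ^+ 2)^-1.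
  rewrite /b -powR_mulrn ?powR_ge0// -powRrM -powRN; congr (_ `^ _); lra.
have ab : a <= b by apply: ge0_ler_powR; rewrite ?nnegrE// ler_nat.
rewrite -lerBrDl -mulrBr -div1r ler_pdivrMr ?exprn_gt0//.
have E1 : (b - a) * (b ^+ 2 + a * b + a ^+ 2) = 1.
  by transitivity (b ^+ 3 - a ^+ 3); [ring|rewrite aE bE; ring].
rewrite -[leLHS]E1 -[leRHS]mulrA [3 * _]mulrC -mulrA ler_wpM2l ?subr_ge0//.
nra.
Qed.

End rates.

(** * Bad rounds *)

Section bad_rounds.
Context {R : realType}.
Implicit Types (gamma v bstar : R) (G : R -> R) (vs ms : nat -> R).

(* At most 1 in total only if the empirical distribution function of the first
   [n] samples is accurate at [bstar / 2] and, relatively to [bstar], at all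
   points of the grid [k / n]. *)
Definition cdf_failure G bstar ms n : R :=
  let L := 2 * ln n%:R in
  chernoff_weight (n%:R * G (bstar / 2)) L (n%:R * ecdf ms n (bstar / 2)) +
  \sum_(0 <= k < n.+1) chernoff_weight (n%:R * `|G (k%:R / n%:R) - G bstar|) L
    (n%:R * `|ecdf ms n (k%:R / n%:R) - ecdf ms n bstar|).

Definition win_sum gamma v vs ms n : R :=
  \sum_(1 <= s < n.+1) (vs s - v) * win gamma vs ms s.

(** With [e] the confidence width after [k] wins, [la = 4 * e] maximizes
    [la * (k * e) - la ^+ 2 / 8 * k], and the maximum [2 * e ^+ 2 * k] equals [gamma * ln n]. *)
Definition hoeffding_rate gamma n k : R := 4 * Num.sqrt (gamma * ln n%:R / (2 * k%:R)).

(* The index [k] ranges over the possible values of the number of wins. *)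
Definition ucb_failure gamma v vs ms n : R :=
  \sum_(1 <= k < n.+1) (
    let la := hoeffding_rate gamma n k in
    let S := win_sum gamma v vs ms n in
    let q := la ^+ 2 / 8 * wins gamma vs ms n + gamma * ln n%:R in
    expR (la * S - q) + expR (- la * S - q)).

Definition failure gamma v G bstar vs ms n : R :=
  cdf_failure G bstar ms n + ucb_failure gamma v vs ms n.

Lemma chernoff_ge0 (m L x : R) : 0 <= chernoff_weight m L x.
Proof. by rewrite addr_ge0 ?expR_ge0. Qed.

Lemma cdf_failure_ge0 G bstar ms n : 0 <= cdf_failure G bstar ms n.
Proof. by rewrite addr_ge0 ?chernoff_ge0// sumr_ge0// => k _; exact: chernoff_ge0. Qed.

Lemma ucb_failure_ge0 gamma v vs ms n : 0 <= ucb_failure gamma v vs ms n.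
Proof. by rewrite sumr_ge0// => k _; rewrite addr_ge0 ?expR_ge0. Qed.

Lemma failure_ge0 gamma v G bstar vs ms n : 0 <= failure gamma v G bstar vs ms n.
Proof. by rewrite addr_ge0 ?cdf_failure_ge0 ?ucb_failure_ge0. Qed.

Lemma ge0_sum_nat_le (u : nat -> R) (m n k : nat) : (forall i, 0 <= u i) ->
  (m <= k < n)%N -> u k <= \sum_(m <= i < n) u i.
Proof.
move=> u0 kn; rewrite (bigD1_seq k)/= ?mem_index_iota ?iota_uniq//.
by rewrite lerDl sumr_ge0.
Qed.

Lemma ln_nat_ge0 (n : nat) : 0 <= ln n%:R :> R.
Proof.
by case: n => [|n]; [rewrite ln0|rewrite ln_ge0// ler1n].
Qed.

(** The first bid is 1, so the first round is won; the number of wins is thus positive and the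
    empirical mean is a genuine quotient. *)
Lemma wins_nat gamma vs ms n : (0 < n)%N -> ms 1%N <= 1 ->
  exists2 k, (1 <= k < n.+1)%N & wins gamma vs ms n = k%:R.
Proof.
move=> n0 m1.
exists (\sum_(1 <= s < n.+1) nat_of_bool (ms s <= ucbid_bid gamma vs ms s)%R)%N; last first.
  by rewrite natr_sum.
apply/andP; split.
  by rewrite big_ltn// ucbid_bid1 m1.
rewrite ltnS; apply: (@leq_trans (\sum_(1 <= s < n.+1) 1)%N).
  by apply: leq_sum => s _; exact: leq_b1.
by rewrite sum_nat_const_nat muln1 subn1.
Qed.

Lemma win_sumE gamma v vs ms n :
  win_sum gamma v vs ms n =
  \sum_(1 <= s < n.+1) vs s * win gamma vs ms s - v * wins gamma vs ms n.
Proof.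
rewrite /win_sum /wins mulr_sumr -sumrB.
by apply: eq_bigr => s _; rewrite mulrBl.
Qed.

(** One summand belongs to the actual number [k] of wins. Its two exponents are negative, which for
    this rate means that the centred sum [S] is below [k * e] in absolute value. *)
Lemma ucb_failure_lt1 gamma v vs ms n : 0 <= gamma -> (0 < n)%N -> ms 1%N <= 1 ->
  ucb_failure gamma v vs ms n < 1 ->
  v <= ucb gamma vs ms n <=
    v + 2 * Num.sqrt (gamma * ln n%:R / (2 * wins gamma vs ms n)).
Proof.
move=> g0 n0 m1; have [k kn kE] := wins_nat gamma vs n0 m1.
have k0 : 0 < k%:R :> R by case/andP: kn => k1 _; rewrite ltr0n.
move=> lt1; set la := hoeffding_rate gamma n k.
set S := win_sum gamma v vs ms n.
set q := la ^+ 2 / 8 * wins gamma vs ms n + gamma * ln n%:R.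
have : expR (la * S - q) + expR (- la * S - q) < 1.
  apply: le_lt_trans lt1; rewrite /ucb_failure.
  pose u i := let la := hoeffding_rate gamma n i in
    let q := la ^+ 2 / 8 * wins gamma vs ms n + gamma * ln n%:R in
    expR (la * S - q) + expR (- la * S - q).
  by apply: (@ge0_sum_nat_le u _ _ _ _ kn) => i; rewrite addr_ge0 ?expR_ge0.
move=> lt.
have e1 : la * S - q < 0.
  by rewrite -expR_lt1; have := expR_gt0 (- la * S - q); lra.
have e2 : - la * S - q < 0.
  by rewrite -expR_lt1; have := expR_gt0 (la * S - q); lra.
rewrite /ucb -/(win_sum gamma v vs ms n) kE.
have -> : \sum_(1 <= s < n.+1) vs s * win gamma vs ms s = S + v * k%:R.
  by rewrite /S win_sumE kE subrK.
move: e1 e2; rewrite /q kE /la /hoeffding_rate; move: (S) => {S} {}S {lt la q}.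
set e := Num.sqrt _ => e1 e2.
have e0 : 0 <= e by exact: sqrtr_ge0.
have eE : e ^+ 2 * (2 * k%:R) = gamma * ln n%:R.
  rewrite sqr_sqrtr; last by rewrite divr_ge0 ?mulr_ge0 ?ln_nat_ge0// ltW.
  by field; rewrite gt_eqF.
rewrite -eE in e1 e2.
(* A zero width would make both exponents 0. *)
have {}e0 : 0 < e.
  rewrite lt_neqAle e0 andbT eq_sym; apply/eqP => e00.
  by move: e1 e2; rewrite e00; lra.
have S1 : S < k%:R * e by nra.
have S2 : - (k%:R * e) < S by nra.
rewrite mulrDl mulfK ?gt_eqF//.
have S3 : S / k%:R < e by rewrite ltr_pdivrMr// mulrC.
have S4 : - e < S / k%:R by rewrite ltr_pdivlMr// mulNr mulrC.
by move: (S / k%:R) S3 S4 => z; lra.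
Qed.

End bad_rounds.

(** * Deterministic analysis of a good round at scale [y] *)

Section good_rounds.
Context {R : realType}.
Variables (gamma v bstar kappa Lam : R) (G : R -> R) (vs ms : nat -> R).
Hypothesis bsv : 0 < bstar < v.
Hypothesis v1 : v <= 1.
Hypothesis Gmono : forall x y : R, x <= y -> G x <= G y.
Hypothesis G_ge0 : forall x, 0 <= G x.
Hypothesis G_le1 : forall x, G x <= 1.
Hypothesis G0 : G 0 = 0.
Hypothesis kappa0 : 0 < kappa.
Hypothesis kappa1 : kappa <= 1.
Hypothesis gap : forall b : R, 0 <= b <= 1 ->
  kappa * (b - bstar) ^+ 2 <= (v - bstar) * G bstar - (v - b) * G b.
Hypothesis Lam1 : 1 <= Lam.
Hypothesis GLam : forall b : R, 0 <= b <= 1 -> `|G b - G bstar| <= Lam * `|b - bstar|.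
Hypothesis ms01 : forall s, (1 <= s)%N -> 0 <= ms s <= 1.

Variables (n : nat) (y : R).
Hypothesis n0 : (0 < n)%N.
Hypothesis y01 : 0 < y <= 1.
Hypothesis yn : n%:R^-1 <= y ^+ 2.
Hypothesis yL : 2 * ln n%:R / n%:R <= y ^+ 3.
Hypothesis good : cdf_failure G bstar ms n < 1.

Let e b := ecdf ms n b.
Let L : R := 2 * ln n%:R.

Let nR0 : 0 < n%:R :> R. Proof. by rewrite ltr0n. Qed.
Let L0 : 0 <= L. Proof. by rewrite mulr_ge0// ln_nat_ge0. Qed.

Lemma chernoff_scaled (m x : R) : 0 <= m -> chernoff_weight (n%:R * m) L (n%:R * x) < 1 ->
  `|x - m| <= 3 * Num.sqrt (m * y ^+ 3) + y ^+ 3.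
Proof.
move=> m0 /chernoff_lt1; rewrite mulr_ge0// => /(_ isT L0) H.
have {}H : n%:R * `|x - m| <= 3 * Num.sqrt (n%:R * m * L) + L.
  by apply: le_trans H; rewrite -mulrBr normrM gtr0_norm.
have LE : L <= n%:R * y ^+ 3 by rewrite -ler_pdivrMl// mulrC.
have sq : Num.sqrt (n%:R * m * L) <= n%:R * Num.sqrt (m * y ^+ 3).
  rewrite -[X in _ <= X * _](ger0_norm (ltW nR0)) -sqrtr_sqr -sqrtrM ?sqr_ge0//.
  rewrite ler_wsqrtr// expr2 -!mulrA ler_wpM2l ?(ltW nR0)//.
  by rewrite [leRHS]mulrCA ler_wpM2l.
by rewrite -(ler_pM2l nR0); lra.
Qed.

Let e0 : e 0 = 0.
Proof.
rewrite /e /ecdf big_nat big1 ?mul0r// => s /andP[s1 _].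
by have /andP[m0 _] := ms01 s1; rewrite ltNge m0.
Qed.

(** The mass between [b] and [bstar] is at most [Lam] times their distance [x], so the Chernoff
    deviation involves the square root of [Lam * x * y ^+ 3], at most [Lam * (x * y + y ^+ 2)]. By
    monotonicity both increments have the same sign, which allows absolute values inside the
    weight. *)
Lemma ecdf_deviation (k : nat) b : (k <= n)%N -> b = k%:R / n%:R ->
  `|(e b - e bstar) - (G b - G bstar)| <=
  4 * Lam * (`|b - bstar| * y + y ^+ 2).
Proof.
move=> kn bE; have /andP[y0 y1] := y01; have L1 := Lam1.
have b01 : 0 <= b <= 1 by rewrite bE divr_ge0//= ler_pdivrMr// mul1r ler_nat.
have ch : chernoff_weight (n%:R * `|G b - G bstar|) L (n%:R * `|e b - e bstar|) < 1.
  apply: le_lt_trans good; rewrite /cdf_failure -/L.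
  apply: le_trans (_ : \sum_(0 <= k < n.+1) chernoff_weight (n%:R * `|G (k%:R / n%:R) - G bstar|) L
    (n%:R * `|ecdf ms n (k%:R / n%:R) - ecdf ms n bstar|) <= _); last first.
    by rewrite lerDr chernoff_ge0.
  pose u i := chernoff_weight (n%:R * `|G (i%:R / n%:R) - G bstar|) L
    (n%:R * `|ecdf ms n (i%:R / n%:R) - ecdf ms n bstar|).
  rewrite bE; apply: (@ge0_sum_nat_le _ u 0 n.+1 k) => // i; exact: chernoff_ge0.
have -> : `|(e b - e bstar) - (G b - G bstar)| = `| `|e b - e bstar| - `|G b - G bstar| |.
  have [bb|bb] := leP b bstar.
    have h1 : e b - e bstar <= 0 by rewrite subr_le0; exact: ecdf_mono.
    have h2 : G b - G bstar <= 0 by rewrite subr_le0; exact: Gmono.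
    by rewrite (ler0_norm h1) (ler0_norm h2) -opprB normrN; congr `|_|; ring.
  have h1 : 0 <= e b - e bstar by rewrite subr_ge0; apply: ecdf_mono; exact: ltW.
  have h2 : 0 <= G b - G bstar by rewrite subr_ge0; apply: Gmono; exact: ltW.
  by rewrite (ger0_norm h1) (ger0_norm h2).
apply: le_trans (chernoff_scaled (normr_ge0 _) ch) _.
have x0 := normr_ge0 (b - bstar).
have sq : Num.sqrt (`|G b - G bstar| * y ^+ 3) <= Lam * (`|b - bstar| * y + y ^+ 2).
  have le1 : `|G b - G bstar| * y ^+ 3 <= (Lam * (`|b - bstar| * y + y ^+ 2)) ^+ 2.
    apply: (@le_trans _ _ (Lam * `|b - bstar| * y ^+ 3)).
      by rewrite ler_wpM2r ?GLam// exprn_ge0// ltW.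
    move: (`|b - bstar|) x0 => x x0.
    have -> : (Lam * (x * y + y ^+ 2)) ^+ 2 = Lam * (Lam * y ^+ 2 * (x + y) ^+ 2) by ring.
    rewrite -mulrA ler_wpM2l//; first by lra.
    have -> : x * y ^+ 3 = y ^+ 2 * (x * y) by ring.
    have -> : Lam * y ^+ 2 * (x + y) ^+ 2 = y ^+ 2 * (Lam * (x + y) ^+ 2) by ring.
    rewrite ler_wpM2l ?sqr_ge0//; apply: (@le_trans _ _ ((x + y) ^+ 2)); first by nra.
    by rewrite ler_peMl// sqr_ge0.
  rewrite (le_trans (ler_wsqrtr le1))// sqrtr_sqr ger0_norm//.
  by rewrite mulr_ge0 ?addr_ge0 ?mulr_ge0 ?sqr_ge0//; lra.
have y3 : y ^+ 3 <= y ^+ 2 by rewrite exprS ler_piMl// ?sqr_ge0// ltW.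
have : y ^+ 2 <= Lam * (`|b - bstar| * y + y ^+ 2).
  by rewrite -[leLHS]mul1r ler_pM ?sqr_ge0// lerDr mulr_ge0// ltW.
lra.
Qed.

(** The grid point 0 serves as reference, since both functions vanish there. *)
Lemma ecdf_deviation_bstar : `|e bstar - G bstar| <= 8 * Lam * y.
Proof.
have /andP[y0 y1] := y01; have /andP[b0 bv] := bsv.
have := @ecdf_deviation 0 0 (leq0n n); rewrite mul0r => /(_ erefl); rewrite e0 G0 !sub0r.
have -> : - e bstar - - G bstar = - (e bstar - G bstar) by ring.
rewrite !normrN (gtr0_norm b0) => /le_trans; apply.
have -> : 8 * Lam * y = 4 * Lam * (2 * y) by ring.
rewrite ler_wpM2l//; last by move: v1; nra.
by move: Lam1; lra.
Qed.

(** The point [bstar / 2] need not lie on the grid and has its own term in [cdf_failure]; it serves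
    to count wins. *)
Lemma ecdf_deviation_half : `|e (bstar / 2) - G (bstar / 2)| <= 4 * y.
Proof.
have /andP[y0 y1] := y01.
have ch : chernoff_weight (n%:R * G (bstar / 2)) L (n%:R * e (bstar / 2)) < 1.
  apply: le_lt_trans good; rewrite /cdf_failure -/L lerDl sumr_ge0// => i _.
  exact: chernoff_ge0.
apply: le_trans (chernoff_scaled (G_ge0 _) ch) _.
have : Num.sqrt (G (bstar / 2) * y ^+ 3) <= y.
  rewrite -[leRHS](ger0_norm (ltW y0)) -sqrtr_sqr ler_wsqrtr//.
  rewrite exprS mulrA -[leRHS]mul1r ler_wpM2r ?sqr_ge0//.
  by have := G_le1 (bstar / 2); have := G_ge0 (bstar / 2); nra.
have : y ^+ 3 <= y by rewrite exprS ler_piMr ?(ltW y0)// expr_le1// ltW.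
lra.
Qed.

Let w := ucb gamma vs ms n.
Let B := ucbid_bid gamma vs ms n.+1.

(* A grid point just above a near-maximizer [b'] is a near-maximizer as well,
   because the factor [ecdf] is nondecreasing. *)
Lemma bid_grid : v <= w -> 8 * Lam * y <= G bstar / 2 ->
    y ^+ 2 < (v - bstar) * G bstar / 2 ->
  exists k : nat, let b := k%:R / n%:R in [/\ (k <= n)%N, `|b - B| <= 2 * y ^+ 2 &
    (w - bstar) * e bstar <= (w - b) * e b + 2 * y ^+ 2].
Proof.
move=> vw ys ys2; have /andP[y0 y1] := y01; have /andP[b0 bv] := bsv.
have ni0 : 0 < n%:R^-1 :> R by rewrite invr_gt0.
have [b' [b'01 b'B]] := @max_argmax_bid_approx _ (fun b => (w - b) * e b) `|w|
  (fun b => @score_le _ ms n w b) _ ni0.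
rewrite -ucbid_bidS// -/B in b'B *.
set sg := sup _ => sgb'.
have gs : (w - bstar) * e bstar <= sg.
  apply: (le_near_argmax_sup (fun b => @score_le _ ms n w b)); move: v1; lra.
have eb : G bstar / 2 <= e bstar.
  by have := ecdf_deviation_bstar; rewrite ler_norml; lra.
have es1 : e b' <= 1 by exact: ecdf_le1.
have es0 : 0 <= e b' by exact: ecdf_ge0.
(* Above [w] the score is at most 0, whereas the supremum is at least [(v - bstar) * G bstar / 2],
   more than the tolerance [n%:R^-1]. *)
have wb' : b' <= w.
  rewrite leNgt; apply/negP => wb'.
  have : (v - bstar) * (G bstar / 2) <= (w - bstar) * e bstar.
    by apply: ler_pM; rewrite ?divr_ge0//; lra.
  have : (w - b') * e b' <= 0 by nra.
  move: yn; lra.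
(* The successor of the integer part of [n * b'], except when [b' = 1], where [n] itself is
   taken. *)
have [k kn bk] : exists2 k : nat, (k <= n)%N & b' <= k%:R / n%:R <= b' + n%:R^-1.
  have x0 : 0 <= n%:R * b' by rewrite mulr_ge0//; case/andP: b'01.
  have /andP[j1 j2] := truncn_itv x0; set j := Num.truncn _ in j1 j2.
  have b'1 : b' <= 1 by case/andP: b'01.
  have [jn|nj] := ltnP j n.
    exists j.+1 => //; rewrite ler_pdivlMr// mulrC (ltW j2)/= ler_pdivrMr// mulrDl.
    by rewrite mulVf ?gt_eqF// -natr1 mulrC lerD2r// mulrC.
  exists n => //; rewrite divff ?gt_eqF// b'1/=.
  have : n%:R <= n%:R * b' by apply: le_trans j1; rewrite ler_nat.
  by rewrite -[leLHS]mulr1 ler_pM2l//; move: ni0; lra.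
exists k => b; split => //.
  move: b'B; rewrite -/b in bk; rewrite ltr_norml ler_norml; move: yn; lra.
rewrite -/b in bk.
have ebb : e b' <= e b by apply: ecdf_mono; case/andP: bk.
have eb1 : e b <= 1 by exact: ecdf_le1.
have eb0 : 0 <= e b by exact: ecdf_ge0.
have h1 : (w - b') * e b' <= (w - b') * e b by rewrite ler_wpM2l// subr_ge0.
have h2 : (b - b') * e b <= n%:R^-1.
  have : 0 <= b - b' <= n%:R^-1 by lra.
  move: (n%:R^-1) ni0 => z z0 ?; nra.
move: yn; lra.
Qed.

(** The error of [ecdf] at [bstar] enters only multiplied by [b - bstar]; the rest involves
    increments. The constant is 4 for the increment, 8 for the error at [bstar] and 2 for the
    near-optimality. The term with [w - v] is left to the caller because its two uses bound it
    differently. *)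
Lemma grid_gap (k : nat) (Z : R) : (k <= n)%N -> let b := k%:R / n%:R in
  (w - bstar) * e bstar <= (w - b) * e b + 2 * y ^+ 2 ->
  (w - v) * (e b - e bstar) <= Z ->
  (v - bstar) * G bstar - (v - b) * G b <=
    Z + 14 * Lam * (`|b - bstar| * y + y ^+ 2).
Proof.
move=> kn b H HZ; have /andP[y0 y1] := y01; have L1 := Lam1; have v1' := v1; have /andP[b0 bv] := bsv.
have b01 : 0 <= b <= 1 by rewrite /b divr_ge0//= ler_pdivrMr// mul1r ler_nat.
have d1 := ecdf_deviation kn (erefl b).
have d2 := ecdf_deviation_bstar.
have x0 := normr_ge0 (b - bstar).
have h1 : (v - b) * ((e b - e bstar) - (G b - G bstar)) <=
    4 * Lam * (`|b - bstar| * y + y ^+ 2).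
  apply: le_trans d1; apply: le_trans (ler_norm _) _; rewrite normrM ler_piMl//.
  by rewrite ler_norml; lra.
have h2 : - ((b - bstar) * (e bstar - G bstar)) <= `|b - bstar| * (8 * Lam * y).
  apply: le_trans (ler_norm _) _; rewrite normrN normrM ler_wpM2l//.
have h3 : y ^+ 2 <= Lam * (`|b - bstar| * y + y ^+ 2).
  by rewrite -[leLHS]mul1r ler_pM ?sqr_ge0// lerDr mulr_ge0// ltW.
have h4 : `|b - bstar| * (8 * Lam * y) <= 8 * Lam * (`|b - bstar| * y + y ^+ 2).
  have -> : `|b - bstar| * (8 * Lam * y) = 8 * Lam * (`|b - bstar| * y) by ring.
  by rewrite ler_wpM2l ?lerDl ?sqr_ge0//; lra.
lra.
Qed.

(** Below [bstar] the term [(w - v) * (e b - e bstar)] is at most 0, by optimism and monotonicity.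
    No upper bound on [w] enters, so this holds before anything is known about the number of
    wins. *)
Lemma bid_ge_half : v <= w -> 8 * Lam * y <= G bstar / 2 ->
    y ^+ 2 < (v - bstar) * G bstar / 2 ->
    (28 * Lam / kappa + 2) * y <= bstar / 2 ->
  bstar / 2 <= B.
Proof.
move=> vw ys1 ys2 ys3; have /andP[y0 y1] := y01; have L1 := Lam1; have k0 := kappa0;
have k1 := kappa1; have /andP[b0 bv] := bsv.
have [k /=] := bid_grid vw ys1 ys2; set b := k%:R / n%:R => -[kn bB H].
have b01 : 0 <= b <= 1 by rewrite /b divr_ge0//= ler_pdivrMr// mul1r ler_nat.
have y2 : y ^+ 2 <= y by rewrite expr2 ler_piMr// ltW.
have q0 : 0 <= 28 * Lam / kappa by rewrite divr_ge0 ?mulr_ge0//; lra.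
have [bb|bb] := leP bstar b.
  move: bB; rewrite ler_norml; have : 0 <= 28 * Lam / kappa * y by rewrite mulr_ge0// ltW.
  lra.
have := @grid_gap k 0 kn H; rewrite -/b add0r.
have -> : (w - v) * (e b - e bstar) <= 0.
  by rewrite mulr_ge0_le0 ?subr_ge0 ?subr_le0//; apply: ecdf_mono; exact: ltW.
move=> /(_ isT) g2; have := le_trans (gap b01) g2; rewrite -real_normK ?num_real// => gq.
have := quadratic_bound k0 _ (normr_ge0 (b - bstar)) y0 gq.
have -> : 2 * (14 * Lam) / kappa = 28 * Lam / kappa by rewrite mulrA; congr (_ * _ / _); lra.
by move=> /(_ ltac:(lra)); move: bB; rewrite !ler_norml; lra.
Qed.

(** With a width of order [y], the term with [w - v] is at most [H * y] times an increment of
    [ecdf], itself [Lam * |b - bstar|] plus its deviation: this is the [5 * H] in [A]. *)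
Lemma grid_utility_gap (H : R) : 1 <= H -> v <= w <= v + H * y ->
    8 * Lam * y <= G bstar / 2 -> y ^+ 2 < (v - bstar) * G bstar / 2 ->
  let A := (14 + 5 * H) * Lam in
  exists b, [/\ `|b - B| <= 2 * y ^+ 2, `|b - bstar| <= 2 * A / kappa * y, 0 <= b <= 1 &
    (v - bstar) * G bstar - (v - b) * G b <= A * (2 * A / kappa + 1) * y ^+ 2].
Proof.
move=> H1 /andP[vw wv] ys1 ys2 A; have /andP[y0 y1] := y01; have L1 := Lam1.
have k0 := kappa0; have k1 := kappa1.
have [k /=] := bid_grid vw ys1 ys2; set b := k%:R / n%:R => -[kn bB HH].
have b01 : 0 <= b <= 1 by rewrite /b divr_ge0//= ler_pdivrMr// mul1r ler_nat.
have x0 := normr_ge0 (b - bstar).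
set r := `|b - bstar| * y + y ^+ 2.
have r0 : 0 <= r by rewrite addr_ge0 ?mulr_ge0 ?sqr_ge0// ltW.
have HZ : (w - v) * (e b - e bstar) <= 5 * H * Lam * r.
  have d1 := ecdf_deviation kn (erefl b); rewrite -/r in d1.
  have h1 : `|e b - e bstar| <= Lam * `|b - bstar| + 4 * Lam * r.
    rewrite -[X in `|X|](subrK (G b - G bstar)) addrC.
    by apply: le_trans (ler_normD _ _) _; rewrite lerD// GLam.
  apply: le_trans (ler_norm _) _; rewrite normrM.
  apply: (@le_trans _ _ (H * y * (Lam * `|b - bstar| + 4 * Lam * r))).
    by apply: ler_pM => //; rewrite ger0_norm ?subr_ge0//; lra.
  have -> : H * y * (Lam * `|b - bstar| + 4 * Lam * r) =
    H * Lam * (`|b - bstar| * y + 4 * (y * r)) by ring.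
  have -> : 5 * H * Lam * r = H * Lam * (r + 4 * r) by ring.
  apply: ler_wpM2l; first by rewrite mulr_ge0; lra.
  by rewrite lerD ?lerDl ?sqr_ge0// ler_wpM2l// ler_piMl.
have g2 := grid_gap kn HH HZ; rewrite -/b -/r /= in g2.
have {}g2 : (v - bstar) * G bstar - (v - b) * G b <= A * r by rewrite /A; lra.
have xK : `|b - bstar| <= 2 * A / kappa * y.
  apply: quadratic_bound kappa0 _ x0 y0 _; first by rewrite /A; nra.
  by rewrite real_normK ?num_real//; exact: le_trans (gap b01) g2.
exists b; split => //; apply: le_trans g2 _.
have A0 : 0 <= A by rewrite /A; nra.
rewrite -mulrA ler_wpM2l// mulrDl mul1r lerD2r expr2 mulrA ler_wpM2r// ltW//.
Qed.

End good_rounds.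

Lemma sum_indic_le (R : realType) (n n0 : nat) :
  \sum_(1 <= s < n.+1) (nat_of_bool (s <= n0)%N)%:R <= n0%:R :> R.
Proof.
rewrite -natr_sum ler_nat.
suff -> : (\sum_(1 <= s < n.+1) (s <= n0)%N = minn n n0)%N by rewrite geq_minr.
elim: n => [|n ih]; first by rewrite big_geq// min0n.
by rewrite big_nat_recr//= ih; case: leqP; lia.
Qed.

Lemma util_diff_le (R : realType) (v b b' : R) (F : R -> R) :
  0 <= v <= 1 -> 0 <= b <= 1 -> 0 <= F b' <= 1 ->
  util v F b - util v F b' <= `|F b - F b'| + `|b - b'|.
Proof.
move=> v01 b01 /andP[F0 F1]; rewrite /util.
have -> : (v - b) * F b - (v - b') * F b' = (v - b) * (F b - F b') - (b - b') * F b'.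
  by ring.
apply: lerD; first (apply: le_trans (ler_norm _) _; rewrite normrM ler_piMl//).
  by rewrite ler_norml; lra.
apply: le_trans (ler_norm _) _; rewrite normrN normrM ler_piMr//.
by rewrite ger0_norm.
Qed.

Lemma util_diff_le2 (R : realType) (v b b' : R) (F : R -> R) :
  0 <= v <= 1 -> 0 <= b <= 1 -> 0 <= b' <= 1 -> (forall x, 0 <= F x <= 1) ->
  util v F b - util v F b' <= 2.
Proof.
move=> v01 b01 b'01 F01; apply: le_trans (util_diff_le v01 b01 (F01 b')) _.
have := F01 b; have := F01 b'; move: (F b) (F b') => x x' x01 x'01.
have : `|x - x'| <= 1 by rewrite ler_norml; lra.
have : `|b - b'| <= 1 by rewrite ler_norml; lra.
lra.
Qed.

(** Linearly many wins make the squared width of order [ln n / n], hence at most of order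
    [y ^+ 3 <= y ^+ 2]. *)
Lemma confidence_width_le (R : realType) (gamma c y W : R) (n : nat) :
  0 <= gamma -> 0 < c -> (0 < n)%N -> 0 < y <= 1 ->
  2 * ln n%:R / n%:R <= y ^+ 3 -> c * n%:R <= W ->
  2 * Num.sqrt (gamma * ln n%:R / (2 * W)) <= Num.sqrt (gamma / c) * y.
Proof.
move=> g0 c0 n0 /andP[y0 y1] yL cW; have nR : 0 < n%:R :> R by rewrite ltr0n.
have -> : Num.sqrt (gamma / c) * y = 2 * (Num.sqrt (gamma / c) * (y / 2)) by field.
rewrite ler_wpM2l// -[y / 2]ger0_norm; last by rewrite divr_ge0// ltW.
rewrite -[`|_|]sqrtr_sqr -sqrtrM; last by rewrite divr_ge0// ltW.
rewrite ler_wsqrtr//.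
apply: (@le_trans _ _ (gamma * ln n%:R / (2 * (c * n%:R)))).
  rewrite ler_wpM2l ?mulr_ge0 ?ln_nat_ge0// lef_pV2 ?posrE ?mulr_gt0//.
    by rewrite ler_pM2l.
  by rewrite (lt_le_trans _ cW)// mulr_gt0.
have -> : gamma * ln n%:R / (2 * (c * n%:R)) =
    gamma / c * (2 * ln n%:R / n%:R / 4).
  by field; rewrite !gt_eqF.
rewrite ler_wpM2l//; first by rewrite divr_ge0// ltW.
have : y ^+ 3 <= y ^+ 2 by rewrite exprS ler_piMl// ?sqr_ge0// ltW.
have -> : (y / 2) ^+ 2 = y ^+ 2 / 4 by field.
by move: yL; move: (2 * ln n%:R / n%:R) => t; lra.
Qed.

(** Compared round by round: a sample below [b] is a win unless the round is among the first [n0] or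
    the preceding failure, which governs the bid, is at least 1. Round 1 has no predecessor but is
    always won. *)
Lemma wins_lower_bound (R : realType) (gamma b : R) (vs ms fl : nat -> R) (n0 n : nat) :
  (0 < n)%N -> ms 1%N <= 1 -> (forall m, 0 <= fl m) ->
  (forall s, (n0 < s)%N -> (1 < s)%N -> fl s.-1 < 1 -> b <= ucbid_bid gamma vs ms s) ->
  n%:R * ecdf ms n b - n0%:R - \sum_(1 <= m < n) fl m <= wins gamma vs ms n.
Proof.
move=> npos m1 fl0 good_bid.
have -> : n%:R * ecdf ms n b = \sum_(1 <= s < n.+1) (nat_of_bool (ms s < b)%R)%:R.
  by rewrite /ecdf mulrC divfK// pnatr_eq0 -lt0n.
have -> : \sum_(1 <= m < n) fl m =
    \sum_(1 <= s < n.+1) if (1 < s)%N then fl s.-1 else 0.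
  rewrite [RHS]big_ltn// add0r big_add1.
  by apply: eq_big_nat => s /andP[s1 _]; rewrite ltnS s1.
apply: (@le_trans _ _ (\sum_(1 <= s < n.+1) ((nat_of_bool (ms s < b)%R)%:R -
  (nat_of_bool (s <= n0)%N)%:R - if (1 < s)%N then fl s.-1 else 0))).
  by rewrite !sumrB lerD2r lerD2l lerN2 sum_indic_le.
rewrite /wins big_nat [leRHS]big_nat; apply: ler_sum => s /andP[s1 sn].
have w01 := win_01 gamma vs ms s.
have fs0 : 0 <= if (1 < s)%N then fl s.-1 else 0 by case: ifP.
have i1 : (nat_of_bool (ms s < b)%R)%:R <= 1 :> R by case: (_ < _)%R.
have [sn0|n0s] := leqP s n0; first by rewrite /=; lra.
rewrite subr0; have [mb|bm] := ltP (ms s) b; last by rewrite /=; lra.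
have [s2|s2] := ltnP 1 s; last first.
  have -> : s = 1%N by apply/eqP; rewrite eqn_leq s2.
  by rewrite /win ucbid_bid1 m1 subr0.
have [fs1|fs1] := leP 1 (fl s.-1); first by rewrite /=; lra.
by rewrite /win (le_trans (ltW mb) (good_bid s n0s s2 fs1)) gerBl.
Qed.

(** * The cost of a good round *)

Section pointwise_bound.
Context {R : realType}.
Variables (gamma v bstar kappa Lam dl LF a : R) (F G : R -> R).
Hypothesis bsv : 0 < bstar < v.
Hypothesis v1 : v <= 1.
Hypothesis gamma0 : 0 <= gamma.
Hypothesis F_ge0 : forall x, 0 <= F x.
Hypothesis F_le1 : forall x, F x <= 1.
Hypothesis Gmono : forall x y : R, x <= y -> G x <= G y.
Hypothesis G_ge0 : forall x, 0 <= G x.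
Hypothesis G_le1 : forall x, G x <= 1.
Hypothesis G0 : G 0 = 0.
Hypothesis G_in : forall b : R, 0 < b < 1 -> G b = F b.
Hypothesis Ghalf : 0 < G (bstar / 2).
Hypothesis kappa0 : 0 < kappa.
Hypothesis kappa1 : kappa <= 1.
Hypothesis gap : forall b : R, 0 <= b <= 1 ->
  kappa * (b - bstar) ^+ 2 <= (v - bstar) * G bstar - (v - b) * G b.
Hypothesis Lam1 : 1 <= Lam.
Hypothesis GLam : forall b : R, 0 <= b <= 1 -> `|G b - G bstar| <= Lam * `|b - bstar|.
Hypothesis dl0 : 0 < dl.
Hypothesis LF0 : 0 <= LF.
Hypothesis dl_bstar : dl <= bstar.
Hypothesis dl_1bstar : dl <= 1 - bstar.
Hypothesis Flip : forall b b' : R, `|b - bstar| < dl -> `|b' - bstar| < dl ->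
  `|F b - F b'| <= LF * `|b - b'|.
Hypothesis a0 : 0 < a.
Hypothesis a1 : a < 3^-1.

(** A lower bound on the fraction of rounds won. *)
Let c : R := G (bstar / 2) / 4.
Let H : R := Num.sqrt (gamma / c) + 1.
Let A : R := (14 + 5 * H) * Lam.
Let K : R := 2 * A / kappa.
Let Gs : R := G bstar.

(** Each of the five arguments secures the corresponding inequality of [smallP]. *)
Let y0 : R := Num.min (Gs / (16 * Lam)) (Num.min ((v - bstar) * Gs / 4)
  (Num.min (bstar / 2 / (28 * Lam / kappa + 2))
  (Num.min (dl / (2 * (K + 2))) (G (bstar / 2) / 8)))).

(** The factor [n ^ a] absorbs logarithms: the cube is [n ^ (3 * a) / n], eventually above
    [2 * ln n / n]. *)
Definition rate (n : nat) : R := n%:R `^ (a - 3^-1).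

Let c0 : 0 < c. Proof. by rewrite divr_gt0. Qed.
Let H1 : 1 <= H. Proof. by rewrite lerDr sqrtr_ge0. Qed.
Let A0 : 0 < A. Proof. by rewrite mulr_gt0//; move: H1 Lam1; lra. Qed.
Let K0 : 0 < K. Proof. by rewrite divr_gt0// mulr_gt0. Qed.
Let Gs0 : 0 < Gs.
Proof.
by apply: lt_le_trans Ghalf _; apply: Gmono; case/andP: bsv => b0 _; lra.
Qed.
Let q0 : 0 < 28 * Lam / kappa + 2.
Proof. by rewrite addr_gt0// divr_gt0// mulr_gt0//; move: Lam1; lra. Qed.

Let y00 : 0 < y0.
Proof.
have L1 := Lam1; have k0 := K0; case/andP: bsv => b0 bv.
by rewrite !lt_min !divr_gt0// ?mulr_gt0 ?subr_gt0//; lra.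
Qed.

Let smallP y : 0 < y <= 1 -> y <= y0 -> [/\ 8 * Lam * y <= Gs / 2,
  y ^+ 2 < (v - bstar) * Gs / 2, (28 * Lam / kappa + 2) * y <= bstar / 2,
  (K + 2) * y < dl & 4 * y <= G (bstar / 2) / 2].
Proof.
move=> /andP[yp y1]; rewrite !le_min => /and5P[h1 h2 h3 h4 h5].
have L1 := Lam1; have k0 := K0; have L16 : 0 < 16 * Lam by lra.
have K2 : 0 < 2 * (K + 2) by lra.
have [b0 bv] := andP bsv; have d0 := dl0.
have vg : 0 < (v - bstar) * Gs by rewrite mulr_gt0// subr_gt0.
split.
- by move: h1; rewrite ler_pdivlMr//; lra.
- by have : y ^+ 2 <= y by [rewrite expr2 ler_piMr// ltW]; lra.
- by rewrite mulrC -ler_pdivlMr.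
- by move: h4; rewrite ler_pdivlMr//; lra.
- lra.
Qed.

Let rateP n : (0 < n)%N -> 0 < rate n <= 1 /\ n%:R^-1 <= rate n ^+ 2.
Proof.
move=> n0; have n1 : 1 <= n%:R :> R by rewrite ler1n.
have l0 := a0; have l1 := a1; split.
  rewrite powR_gt0 ?ltr0n//= -[leRHS](powRr0 n%:R) ler_powR//; lra.
rewrite -powR_mulrn ?powR_ge0// -powRrM -[leLHS]powR_inv1 ?ler0n// ler_powR//; lra.
Qed.

Let eventually_small : exists n0 : nat, forall n, (n0 <= n)%N -> (0 < n)%N ->
  rate n <= y0 /\ 2 * ln n%:R / n%:R <= rate n ^+ 3.
Proof.
have l0 := a0; have l1 := a1.
have [n1 H1'] := @powR_eventually_ge R (3^-1 - a) y0^-1 ltac:(lra).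
have [n2 H2'] := @ln_eventually_le_powR R (3 * a) ltac:(lra).
exists (maxn n1 n2) => n; rewrite geq_max => /andP[nn1 nn2] n0; split.
  have -> : rate n = (n%:R `^ (3^-1 - a))^-1 by rewrite -powRN opprB.
  by rewrite -[leRHS]invrK lef_pV2 ?posrE ?powR_gt0 ?ltr0n ?invr_gt0//; exact: H1'.
have -> : rate n ^+ 3 = n%:R `^ (3 * a) / n%:R.
  rewrite -powR_mulrn ?powR_ge0// -powRrM -[n%:R^-1]powR_inv1 ?ler0n//.
  rewrite -powRD; last by apply/implyP; rewrite pnatr_eq0 -lt0n n0.
  by congr (_ `^ _); lra.
by rewrite ler_pM2r ?invr_gt0 ?ltr0n//; exact: H2'.
Qed.

(** The average of earlier failures appears because these may spoil the count of wins, hence the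
    width at round [n]. Whenever something goes wrong, a term on the right is bounded below, while a
    gap is never above 2. *)
Lemma pointwise_gap : exists2 C : R, 0 <= C & forall vs ms : nat -> R,
  (forall s, (1 <= s)%N -> 0 <= ms s <= 1) ->
  forall n, (0 < n)%N ->
  util v F bstar - util v F (ucbid_bid gamma vs ms n.+1) <=
  C * (rate n ^+ 2 + failure gamma v G bstar vs ms n +
       (\sum_(1 <= m < n) failure gamma v G bstar vs ms m) / n%:R).
Proof.
have [n0 Hn0] := eventually_small.
pose F1 := G (bstar / 2); have F10 : 0 < F1 by [].
have [b0 bv] := andP bsv.
have v01 : 0 <= v <= 1 by rewrite v1 andbT ltW// (lt_trans b0).
have bs01 : 0 < bstar < 1 by rewrite b0 (lt_le_trans bv).
have bs01' : 0 <= bstar <= 1 by case/andP: bs01 => ? ?; rewrite !ltW.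
have GsE : Gs = F bstar by exact: G_in.
(* One summand per case: [n < n0]; a failure at [n]; too many earlier failures; [n] too small for
   [n0] lost rounds to be negligible; a good round. *)
pose C := 2 * n0%:R + 2 + 16 / F1 + 16 * n0%:R / F1 + (A * (K + 1) + 2 * LF + 2).
have [C0 [C1 C2] [C3 C4] C5] : [/\ 0 <= C, 2 * n0%:R <= C /\ 2 <= C,
    16 / F1 <= C /\ 16 * n0%:R / F1 <= C & A * (K + 1) + 2 * LF + 2 <= C].
  have d0 : 0 <= 16 * n0%:R / F1 by rewrite divr_ge0 ?mulr_ge0// ltW.
  have d1 : 0 <= 16 / F1 by rewrite divr_ge0// ltW.
  have d2 : 0 <= A * (K + 1) by rewrite mulr_ge0 ?addr_ge0// ltW.
  have d3 : 0 <= 2 * LF by rewrite mulr_ge0.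
  have d4 : 0 <= n0%:R :> R by [].
  by rewrite /C; do !split; lra.
exists C => // vs ms ms01 n npos.
have m1 : ms 1%N <= 1 by case/andP: (ms01 1%N isT).
pose B s := ucbid_bid gamma vs ms s.
pose fl m := failure gamma v G bstar vs ms m.
have fl0 m : 0 <= fl m by exact: failure_ge0.
rewrite -/(B n.+1) -/(fl n).
have nR0 : 0 < n%:R :> R by rewrite ltr0n.
have [y01 yn] := rateP npos; set y := rate n in y01 yn *.
set Sg := (\sum_(1 <= m < n) _) / _.
have Sg0 : 0 <= Sg by rewrite divr_ge0// sumr_ge0// => m _; exact: fl0.
have y20 := sqr_ge0 y; have fln0 := fl0 n.
have B01 : 0 <= B n.+1 <= 1 by exact: ucbid_bid01.
have gap2 : util v F bstar - util v F (B n.+1) <= 2.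
  by apply: util_diff_le2 => // x; rewrite F_ge0 F_le1.
have [ty tf ts] : [/\ y ^+ 2 <= y ^+ 2 + fl n + Sg, fl n <= y ^+ 2 + fl n + Sg &
    Sg <= y ^+ 2 + fl n + Sg].
  by split; lra.
have useC C' t : 0 <= t -> C' <= C -> 2 <= C' * t ->
    t <= y ^+ 2 + fl n + Sg ->
    util v F bstar - util v F (B n.+1) <= C * (y ^+ 2 + fl n + Sg).
  move=> t0 C'C C't tle; apply: le_trans gap2 _; apply: le_trans C't _.
  by apply: (@le_trans _ _ (C * t)); [rewrite ler_wpM2r|rewrite ler_wpM2l].
have [nn0|n0n] := ltnP n n0.
  apply: (useC (2 * n0%:R) (y ^+ 2)) => //.
  have : 1 <= n0%:R * y ^+ 2.
    apply: (@le_trans _ _ (n0%:R * n%:R^-1)); last by rewrite ler_wpM2l.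
    by rewrite ler_pdivlMr// mul1r ler_nat ltnW.
  lra.
have [fl1|fl1] := leP 1 (fl n).
  by apply: (useC 2 (fl n)) => //; rewrite ler_peMr.
have [Sg1|Sg1] := leP (F1 / 8) Sg.
  apply: (useC (16 / F1) Sg) => //; rewrite mulrAC ler_pdivlMr//.
  by lra.
have [n01|n01] := leP (n%:R * F1 / 8) n0%:R.
  apply: (useC (16 * n0%:R / F1) (y ^+ 2)) => //.
  rewrite mulrAC ler_pdivlMr//.
  have : n%:R^-1 * (n%:R * F1 / 8) <= y ^+ 2 * n0%:R.
    by apply: ler_pM => //; rewrite ?invr_ge0 ?divr_ge0 ?mulr_ge0// ltW.
  rewrite mulrA mulrA mulVf ?gt_eqF// mul1r; lra.
have small m : (0 < m)%N -> fl m < 1 ->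
    v <= ucb gamma vs ms m <= v + 2 * Num.sqrt (gamma * ln m%:R / (2 * wins gamma vs ms m)) /\
    cdf_failure G bstar ms m < 1.
  move=> m0 lt; split.
    apply: ucb_failure_lt1 => //; apply: le_lt_trans lt.
    by rewrite lerDr cdf_failure_ge0.
  by apply: le_lt_trans lt; rewrite lerDl ucb_failure_ge0.
have good_bid s : (n0 < s)%N -> (1 < s)%N -> fl s.-1 < 1 -> bstar / 2 <= B s.
  case: s => [//|m] n0m m0 flm.
  have [/andP[vw _] cf] := small m m0 flm.
  have [ym01 ymn] := rateP m0; have [ym0 ymL] := Hn0 m n0m m0.
  have [h1 h2 h3 h4 h5] := smallP ym01 ym0.
  exact: (bid_ge_half bsv v1 Gmono G_ge0 G0 kappa0 kappa1 gap Lam1 GLam ms01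
    m0 ym01 ymn ymL cf vw h1 h2 h3).
have [y_y0 yL] := Hn0 n n0n npos; rewrite -/y in y_y0 yL.
have [h1 h2 h3 h4 h5] := smallP y01 y_y0.
have [/andP[vw wv] cf] := small n npos fl1.
(* At least [n * F1 / 2] samples lie below [bstar / 2]; the first [n0] rounds and the earlier
   failures each remove at most [n * F1 / 8]. *)
have many_wins : c * n%:R <= wins gamma vs ms n.
  have := wins_lower_bound npos m1 fl0 good_bid.
  have -> : \sum_(1 <= m < n) fl m = n%:R * Sg by rewrite /Sg mulrC divfK// gt_eqF.
  have := ecdf_deviation_half G_ge0 G_le1 npos y01 yL cf; rewrite ler_norml => /andP[dev _].
  have h6 : n%:R * (F1 / 2) <= n%:R * ecdf ms n (bstar / 2).
    by rewrite ler_wpM2l ?(ltW nR0)// /F1; lra.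
  have h7 : n%:R * Sg <= n%:R * (F1 / 8) by rewrite ler_wpM2l ?(ltW nR0)// ltW.
  by rewrite /c -/F1; lra.
have [yp y1] := andP y01.
have vwH : v <= ucb gamma vs ms n <= v + H * y.
  rewrite vw/=; apply: le_trans wv _; rewrite lerD2l.
  apply: le_trans (confidence_width_le gamma0 c0 npos y01 yL many_wins) _.
  by rewrite /H mulrDl mul1r lerDl ltW.
have := grid_utility_gap bsv v1 Gmono G_ge0 G0 kappa0 kappa1 gap Lam1 GLam ms01
  npos y01 yn yL cf H1 vwH h1 h2.
rewrite /= -/A -/K -/(B n.+1) => -[b [bB bK b01 gb]].
have y2y : y ^+ 2 <= y by rewrite expr2 ler_piMr// ltW.
(* The bid is within [2 * y] of [b], itself within [K * y] of [bstar], so both lie where [F] is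
   Lipschitz. *)
have [bd Bd] : `|b - bstar| < dl /\ `|B n.+1 - bstar| < dl.
  have := mulr_ge0 (ltW K0) (ltW yp); move: bB bK.
  by rewrite !ler_norml !ltr_norml; split; lra.
have bin : 0 < b < 1.
  by move: bd dl_bstar dl_1bstar; rewrite ltr_norml; lra.
rewrite (G_in bin) -/Gs GsE -/(util v F bstar) -/(util v F b) in gb.
have FF := Flip bd Bd.
have FB01 : 0 <= F (B n.+1) <= 1 by rewrite F_ge0 F_le1.
have ub := util_diff_le v01 b01 FB01.
have FF2 : `|F b - F (B n.+1)| <= LF * (2 * y ^+ 2).
  by apply: le_trans FF _; rewrite ler_wpM2l.
apply: (@le_trans _ _ ((A * (K + 1) + 2 * LF + 2) * y ^+ 2)); last first.
  by apply: (@le_trans _ _ (C * y ^+ 2)); [rewrite ler_wpM2r|rewrite ler_wpM2l].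
lra.
Qed.

End pointwise_bound.

Lemma sum_affine (R : realType) (u : nat -> R) (l p q : R) (n : nat) :
  \sum_(1 <= s < n.+1) (l * (u s - p) - q) =
  l * (\sum_(1 <= s < n.+1) u s - n%:R * p) - n%:R * q.
Proof.
elim: n => [|n ih]; first by rewrite !big_geq//; ring.
by rewrite big_nat_recr//= ih [in RHS]big_nat_recr//= -natr1; ring.
Qed.

(** * Expected number of bad rounds *)

Section expected_failure.
Context {d : measure_display} {Omega : measurableType d} {R : realType}
  (P : probability Omega R).
Local Open Scope ereal_scope.

(** Replacing the exponential by its chord reduces [Y] to a Bernoulli variable of the same mean. *)
Lemma expectation_expR_le (Y : Omega -> R) (p l : R) :
  measurable_fun setT Y -> (forall w, 0 <= Y w <= 1)%R ->
  \int[P]_w (Y w)%:E = p%:E ->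
  \int[P]_w (expR (l * Y w))%:E <= (1 - p + p * expR l)%:E.
Proof.
move=> mY Y01 Yp.
have Y0 w : (0 <= Y w)%R by case/andP: (Y01 w).
have Y1 w : (0 <= 1 - Y w)%R by rewrite subr_ge0; case/andP: (Y01 w).
have m1 : measurable_fun setT (fun w => 1 - Y w)%R by exact: measurable_funB.
have E1 : \int[P]_w (1 - Y w)%:E = (1 - p)%:E.
  have : \int[P]_w (1 - Y w)%:E + p%:E = 1%:E.
    rewrite -Yp -ge0_integralD//.
    - under eq_integral do rewrite -EFinD subrK.
      by rewrite integral_cst// mul1e; exact: probability_setT.
    - by move=> w _; rewrite lee_fin.
    - exact/measurable_EFinP.
    - by move=> w _; rewrite lee_fin.
    - exact/measurable_EFinP.
  by move=> /(congr1 (fun x => x - p%:E)); rewrite addeK// EFinB.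
apply: (@le_trans _ _ (\int[P]_w ((1 - Y w)%:E + (expR l)%:E * (Y w)%:E))).
  apply: ge0_le_integral => //.
  - apply/measurable_EFinP; apply: measurableT_comp; first exact: measurable_expR.
    exact: measurable_funM.
  - apply/measurable_EFinP; apply: measurable_funD => //; exact: measurable_funM.
  - move=> w _; rewrite -EFinM -EFinD lee_fin [X in (_ + X)%R]mulrC.
    exact: expR_convex01.
rewrite ge0_integralD//; last 4 first.
- by move=> w _; rewrite lee_fin.
- exact/measurable_EFinP.
- by move=> w _; rewrite -EFinM lee_fin mulr_ge0// expR_ge0.
- by apply/measurable_EFinP/measurable_funM.
rewrite ge0_integralZl_EFin ?expR_ge0//; last 2 first.
- by move=> w _; rewrite lee_fin.
- exact/measurable_EFinP.
by rewrite E1 Yp -EFinM -EFinD lee_fin mulrC.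
Qed.

Lemma integral_mulr_expR (Y : Omega -> R) (c q : R) :
  measurable_fun setT Y -> \int[P]_w (expR (Y w))%:E <= (expR c)%:E ->
  \int[P]_w (expR (Y w - q))%:E <= (expR (c - q))%:E.
Proof.
move=> mY le.
under eq_integral do rewrite expRD mulrC EFinM.
rewrite ge0_integralZl_EFin ?expR_ge0//.
- by rewrite addrC expRD EFinM lee_wpmul2l// lee_fin expR_ge0.
by apply/measurable_EFinP; apply: measurableT_comp => //; exact: measurable_expR.
Qed.

Variables (V M : nat -> Omega -> R) (v gamma : R).
Hypothesis mV : forall t, (1 <= t)%N -> measurable_fun setT (V t).
Hypothesis V01 : forall t w, (1 <= t)%N -> (0 <= V t w <= 1)%R.
Hypothesis Vid : forall t A, (1 <= t)%N -> measurable A ->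
  P (V t @^-1` A) = P (V 1%N @^-1` A).
Hypothesis EV : \int[P]_w (V 1%N w)%:E = v%:E.
Hypothesis mM : forall t, (1 <= t)%N -> measurable_fun setT (M t).
Hypothesis M01 : forall t w, (1 <= t)%N -> (0 <= M t w <= 1)%R.

Let X (i : bool * nat) : Omega -> R := if i.1 then V i.2 else M i.2.
Let T0 : set (bool * nat) := [set i : bool * nat | (1 <= i.2)%N].
Hypothesis indX : mutually_independent P T0 X.

Let mX i : T0 i -> measurable_fun setT (X i).
Proof. by case: i => -[] t /= t1; [exact: mV|exact: mM]. Qed.

Lemma expectation_identically_distributed (t : nat) : (1 <= t)%N ->
  \int[P]_w (V t w)%:E = v%:E.
Proof.
move=> t1; rewrite -EV.
pose Vt : {mfun Omega >-> R} := mfun_Sub (mem_set (mV t1)).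
pose V1 : {mfun Omega >-> R} := mfun_Sub (mem_set (mV (leqnn 1))).
have mn : measurable_fun setT (fun x : R => `|x|%:E : \bar R).
  by apply/measurable_EFinP; exact: normr_measurable.
transitivity (\int[distribution P Vt]_x `|x|%:E).
  rewrite ge0_integral_distribution//; apply: eq_integral => w _ /=.
  by rewrite ger0_norm//; case/andP: (V01 w t1).
transitivity (\int[distribution P V1]_x `|x|%:E).
  by apply: eq_measure_integral => A mA _; exact: Vid.
rewrite ge0_integral_distribution//; apply: eq_integral => w _ /=.
by rewrite ger0_norm//; case/andP: (V01 w (leqnn 1)).
Qed.

Lemma mean01 : (0 <= v <= 1)%R.
Proof.
rewrite -!lee_fin -EV; apply/andP; split.
  by apply: integral_ge0 => w _; rewrite lee_fin; case/andP: (V01 w (leqnn 1)).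
apply: (@le_trans _ _ (\int[P]_w 1)); last first.
  by rewrite integral_cst// mul1e probability_le1.
apply: ge0_le_integral => //.
- by move=> w _; rewrite lee_fin; case/andP: (V01 w (leqnn 1)).
- exact/measurable_EFinP/mV.
- by move=> w _; rewrite lee_fin; case/andP: (V01 w (leqnn 1)).
Qed.

Lemma hoeffding_mgf (t : nat) (l : R) : (1 <= t)%N ->
  \int[P]_w (expR (l * (V t w - v) - l ^+ 2 / 8))%:E <= 1.
Proof.
move=> t1; rewrite (_ : 1 = (expR ((l * v + l ^+ 2 / 8) - (l * v + l ^+ 2 / 8)))%:E); last first.
  by rewrite subrr expR0.
have -> : \int[P]_w (expR (l * (V t w - v) - l ^+ 2 / 8))%:E =
    \int[P]_w (expR (l * V t w - (l * v + l ^+ 2 / 8)))%:E.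
  by apply: eq_integral => w _; congr (expR _)%:E; ring.
apply: integral_mulr_expR; first by apply: measurable_funM => //; exact: mV.
apply: le_trans (expectation_expR_le l (mV t1) (fun w => V01 w t1)
  (expectation_identically_distributed t1)) _.
by rewrite lee_fin; apply: bernoulli_mgf_le; exact: mean01.
Qed.

(** As a win is 0 or 1, each exponential factor has the form [1 + W * (h - 1)]. *)
Lemma hoeffding_supermartingale (l : R) (n : nat) :
  \int[P]_w (expR (l * win_sum gamma v (V ^~ w) (M ^~ w) n -
    l ^+ 2 / 8 * wins gamma (V ^~ w) (M ^~ w) n))%:E <= 1.
Proof.
pose W s w := win gamma (V ^~ w) (M ^~ w) s.
pose h (s : nat) (x : R) := expR (l * (x - v) - l ^+ 2 / 8).
(* The past of [V s] consists of the earlier values and of all [M], so that winning round [s] is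
   already decided. *)
pose S (s : nat) : set (bool * nat) :=
  [set i : bool * nat | (1 <= i.2)%N /\ (i.1 -> (i.2 < s)%N)].
have -> : \int[P]_w (expR (l * win_sum gamma v (V ^~ w) (M ^~ w) n -
    l ^+ 2 / 8 * wins gamma (V ^~ w) (M ^~ w) n))%:E =
  \int[P]_w (\prod_(1 <= s < n.+1) (1 + W s w * (h s (X (true, s) w) - 1)))%:E.
  apply: eq_integral => w _; congr (_)%:E.
  rewrite /win_sum /wins !mulr_sumr -sumrB expR_sum; apply: eq_bigr => s _.
  rewrite /W /win; case: (_ <= _)%R => /=.
    by rewrite !mulr1 mul1r [RHS]addrC subrK.
  by rewrite !mulr0 subrr expR0 mul0r addr0.
apply: (supermartingale_prod indX mX (S := S) (j := fun s => (true, s)) (h := h)).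
- by move=> s s1; split => //= [i []//|[_ /(_ isT)]]; rewrite ltnn.
- move=> r s /andP[r1 rs]; split => //= i [i1 H]; split => // /H ir.
  exact: ltn_trans rs.
- move=> s s1; apply: (@measurable_win _ _
    (g_sigma_algebraType (cylinders X (S s))) V M) => // r /andP[r1 rs].
    by apply: (@measurable_fun_sigma_coord _ _ _ _ X (S s) (true, r)).
  by apply: (@measurable_fun_sigma_coord _ _ _ _ X (S s) (false, r)).
- move=> s s1; apply: measurableT_comp; first exact: measurable_expR.
  by apply: measurable_funB => //; apply: measurable_funM => //; exact: measurable_funB.
- by move=> s w _; exact: win_01.
- by move=> s x _; exact: expR_ge0.
- by move=> s s1; exact: hoeffding_mgf.
Qed.

(** A supermartingale without switch: with [l <= 1], [p * (expR l - 1)] is at most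
    [p * (l + 2 * l ^+ 2)]. *)
Lemma chernoff_supermartingale (h : R -> R) (p l : R) (n : nat) :
  measurable_fun setT h -> (forall x, 0 <= h x <= 1)%R -> (l <= 1)%R ->
  (forall t, (1 <= t)%N -> \int[P]_w (h (M t w))%:E = p%:E) ->
  \int[P]_w (expR (l * (\sum_(1 <= s < n.+1) h (M s w) - n%:R * p) -
    2 * (n%:R * p) * l ^+ 2))%:E <= 1.
Proof.
move=> mh h01 l1 Ep.
have p0 : (0 <= p)%R.
  rewrite -lee_fin -(Ep 1%N)//; apply: integral_ge0 => w _.
  by rewrite lee_fin; case/andP: (h01 (M 1%N w)).
pose g (s : nat) (x : R) := expR (l * (h x - p) - 2 * p * l ^+ 2).
pose S (s : nat) : set (bool * nat) := [set i : bool * nat | (1 <= i.2 < s)%N].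
have -> : \int[P]_w (expR (l * (\sum_(1 <= s < n.+1) h (M s w) - n%:R * p) -
    2 * (n%:R * p) * l ^+ 2))%:E =
  \int[P]_w (\prod_(1 <= s < n.+1) (1 + 1 * (g s (X (false, s) w) - 1)))%:E.
  apply: eq_integral => w _; congr (_)%:E.
  transitivity (\prod_(1 <= s < n.+1) g s (M s w))%R; last first.
    by apply: eq_bigr => s _; rewrite mul1r addrC subrK.
  rewrite /g -expR_sum; congr expR.
  by rewrite (sum_affine (fun s => h (M s w))); ring.
apply: (supermartingale_prod indX mX (S := S) (j := fun s => (false, s)) (h := g)
  (W := fun _ _ => 1%R)).
- move=> s s1; split => //=; first by move=> i /andP[].
  by move=> /andP[_]; rewrite /= ltnn.
- move=> r s /andP[r1 rs]; split; last by apply/andP.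
  by move=> i /andP[i1 ir]; rewrite /S/= i1 (ltn_trans ir).
- by move=> s s1; exact: measurable_cst.
- move=> s s1; apply: measurableT_comp; first exact: measurable_expR.
  by apply: measurable_funB => //; apply: measurable_funM => //; exact: measurable_funB.
- by move=> s w _; rewrite ler01 lexx.
- by move=> s x _; exact: expR_ge0.
- move=> s s1; rewrite (_ : 1 = (expR ((p * (l + 2 * l ^+ 2)) - (p * (l + 2 * l ^+ 2))))%:E); last first.
    by rewrite subrr expR0.
  have -> : \int[P]_w (g s (X (false, s) w))%:E =
      \int[P]_w (expR (l * h (M s w) - p * (l + 2 * l ^+ 2)))%:E.
    by apply: eq_integral => w _; congr (expR _)%:E; rewrite /=; ring.
  have mhM : measurable_fun setT (fun w => h (M s w)).
    by apply: measurableT_comp => //; exact: mM.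
  apply: integral_mulr_expR; first exact: measurable_funM.
  apply: le_trans (expectation_expR_le l mhM (fun w => h01 _) (Ep s s1)) _.
  rewrite lee_fin; apply: (@le_trans _ _ (expR (p * (expR l - 1)))).
    by apply: le_trans (expR_ge1Dx _); lra.
  by rewrite ler_expR ler_wpM2l//; have := expR_le_quad l1; lra.
Qed.

Lemma expectation_add_le (f g : Omega -> R) (a b : R) :
  measurable_fun setT f -> measurable_fun setT g ->
  (forall w, 0 <= f w)%R -> (forall w, 0 <= g w)%R ->
  \int[P]_w (f w)%:E <= a%:E -> \int[P]_w (g w)%:E <= b%:E ->
  \int[P]_w (f w + g w)%:E <= (a + b)%:E.
Proof.
move=> mf mg f0 g0 fa gb; under eq_integral do rewrite EFinD.
rewrite ge0_integralD//; first by rewrite EFinD leeD.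
- by move=> w _; rewrite lee_fin.
- exact/measurable_EFinP.
- by move=> w _; rewrite lee_fin.
- exact/measurable_EFinP.
Qed.

Lemma expectation_sum_le (u : nat -> Omega -> R) (c : nat -> R) (m n : nat) :
  (forall k, measurable_fun setT (u k)) -> (forall k w, 0 <= u k w)%R ->
  (forall k, (m <= k < n)%N -> \int[P]_w (u k w)%:E <= (c k)%:E) ->
  \int[P]_w (\sum_(m <= k < n) u k w)%:E <= (\sum_(m <= k < n) c k)%:E.
Proof.
move=> mu u0 uc; under eq_integral do rewrite -sumEFin.
rewrite ge0_integral_sum//; last 2 first.
- by move=> k; exact/measurable_EFinP.
- by move=> k w _; rewrite lee_fin.
rewrite -sumEFin big_nat_cond [leRHS]big_nat_cond.
by apply: lee_sum => k /andP[kn _]; exact: uc.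
Qed.

(** * The left limit of the distribution function, and failure probabilities *)

Variable F : R -> R.
Hypothesis MF : forall t x, (1 <= t)%N -> P [set w | (M t w <= x)%R] = (F x)%:E.

Definition left_cdf (b : R) : R := fine (P [set w | (M 1%N w < b)%R]).

Let mlt t b : (1 <= t)%N -> measurable [set w | (M t w < b)%R].
Proof.
move=> t1; rewrite (_ : [set w | _] = M t @^-1` `]-oo, b[); last first.
  by apply/seteqP; split => w /=; rewrite in_itv.
by rewrite -[X in measurable X]setTI; apply: mM.
Qed.

Let mle t b : (1 <= t)%N -> measurable [set w | (M t w <= b)%R].
Proof.
move=> t1; rewrite (_ : [set w | _] = M t @^-1` `]-oo, b]); last first.
  by apply/seteqP; split => w /=; rewrite in_itv.
by rewrite -[X in measurable X]setTI; apply: mM.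
Qed.

(** The laws of the [M t] are given only through [F]; this recovers strict events, with a limit that
    is the same for all [t]. *)
Lemma cdf_left_limit t b : (1 <= t)%N ->
  (fun k : nat => (F (b - k.+1%:R^-1))%:E) @ \oo --> P [set w | (M t w < b)%R].
Proof.
move=> t1; pose E (k : nat) := [set w | (M t w <= b - k.+1%:R^-1)%R].
have -> : [set w | (M t w < b)%R] = \bigcup_k E k.
  apply/seteqP; split => w /=.
    move=> wb; have : (0 < b - M t w)%R by rewrite subr_gt0.
    move=> /ltr_add_invr[k]; rewrite add0r => kb; exists k => //.
    by rewrite /E/= lerBrDr -lerBrDl ltW.
  move=> [k _]; rewrite /E/= => /le_lt_trans; apply.
  by rewrite ltrBlDr ltrDl invr_gt0.
have -> : (fun k : nat => (F (b - k.+1%:R^-1))%:E) = P \o E.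
  by apply/funext => k; rewrite /= MF.
apply: nondecreasing_cvg_mu => //.
- by move=> k; exact: mle.
- by apply: bigcup_measurable => k _; exact: mle.
- move=> i j ij; apply/subsetPset => w; rewrite /E/= => /le_trans; apply.
  by rewrite lerD2l lerN2 lef_pV2 ?posrE ?ltr0n// ler_nat ltnS.
Qed.

Lemma left_cdfE t b : (1 <= t)%N -> P [set w | (M t w < b)%R] = (left_cdf b)%:E.
Proof.
move=> t1; rewrite /left_cdf fineK ?fin_num_measure//; last exact: mlt.
by apply: (cvg_unique _ (@cdf_left_limit t b t1) (@cdf_left_limit 1%N b (leqnn 1))).
Qed.

Lemma cdf_mono (x y : R) : (x <= y)%R -> (F x <= F y)%R.
Proof.
move=> xy; rewrite -lee_fin -!(MF _ (leqnn 1)) le_measure ?inE//; try exact: mle.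
by move=> w /= /le_trans; apply.
Qed.

Lemma cdf_ge0 x : (0 <= F x)%R.
Proof. by rewrite -lee_fin -(MF _ (leqnn 1)). Qed.

Lemma cdf_le1 x : (F x <= 1)%R.
Proof. by rewrite -lee_fin -(MF _ (leqnn 1)) probability_le1//; exact: mle. Qed.

Lemma cdf_neg (x : R) : (x < 0)%R -> F x = 0%R.
Proof.
move=> x0; apply: EFin_inj; rewrite -(MF _ (leqnn 1)) (_ : [set w | _] = set0) ?measure0//.
apply/seteqP; split => w //= /le_lt_trans /(_ x0).
by rewrite ltNge; have /andP[-> _] := M01 w (leqnn 1).
Qed.

Lemma left_cdf_le b : (left_cdf b <= F b)%R.
Proof.
rewrite -lee_fin -(left_cdfE b (leqnn 1)) -(MF _ (leqnn 1)).
by apply: le_measure; rewrite ?inE; [exact: mlt|exact: mle|move=> w /= /ltW].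
Qed.

Lemma left_cdf_ge0 b : (0 <= left_cdf b)%R.
Proof. by rewrite fine_ge0. Qed.

Lemma left_cdf_le1 b : (left_cdf b <= 1)%R.
Proof. exact: le_trans (left_cdf_le b) (cdf_le1 b). Qed.

Lemma left_cdf_mono (x y : R) : (x <= y)%R -> (left_cdf x <= left_cdf y)%R.
Proof.
move=> xy; rewrite -lee_fin -!(left_cdfE _ (leqnn 1)) le_measure ?inE//; try exact: mlt.
by move=> w /= /lt_le_trans; apply.
Qed.

Lemma left_cdf_npos (b : R) : (b <= 0)%R -> left_cdf b = 0%R.
Proof.
move=> b0; apply: EFin_inj; rewrite -(left_cdfE _ (leqnn 1)) (_ : [set w | _] = set0) ?measure0//.
apply/seteqP; split => w //= /lt_le_trans /(_ b0).
by rewrite ltNge; have /andP[-> _] := M01 w (leqnn 1).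
Qed.

(** A jump [e > 0] would give [F (b - s) <= F b - e], while differentiability bounds the change over
    [s] by [L * s <= e / 2]. *)
Lemma left_cdf_derivable (b l : R) : is_derive b (1%R : R) F l -> left_cdf b = F b.
Proof.
move=> /is_derive_lipschitz_at [dl dl0 H]; apply/eqP; rewrite eq_le left_cdf_le/=.
rewrite leNgt; apply/negP => lt; set e := (F b - left_cdf b)%R.
have e0 : (0 < e)%R by rewrite subr_gt0.
set L := (1 + `|l|)%R; have L0 : (0 < L)%R by rewrite ltr_wpDr.
pose s : R := Num.min (dl / 2)%R (e / (2 * L))%R.
have s0 : (0 < s)%R by rewrite lt_min !divr_gt0// mulr_gt0.
have sd : (s <= dl / 2)%R by rewrite ge_min lexx.
have : (s <= e / (2 * L))%R by rewrite ge_min lexx orbT.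
rewrite ler_pdivlMr ?mulr_gt0// => sL.
have := H (b - s)%R; rewrite addrAC subrr add0r normrN gtr0_norm// => /(_ ltac:(lra)).
have : (F (b - s) <= left_cdf b)%R.
  rewrite -lee_fin -(left_cdfE b (leqnn 1)) -(MF _ (leqnn 1)).
  apply: le_measure; rewrite ?inE; [exact: mle|exact: mlt|move=> w /= /le_lt_trans].
  by apply; rewrite ltrBlDr ltrDl.
rewrite ler_norml -/L => h1 /andP[h2 _].
have eE : (e = F b - left_cdf b)%R by [].
lra.
Qed.

Lemma expectation_interval (t : nat) (x y : R) : (1 <= t)%N -> (x <= y)%R ->
  \int[P]_w (\1_(`[x, y[) (M t w) : R)%:E = (left_cdf y - left_cdf x)%:E.
Proof.
move=> t1 xy; have mI : measurable (M t @^-1` `[x, y[).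
  by rewrite -[X in measurable X]setTI; apply: mM.
transitivity (P (M t @^-1` `[x, y[)).
  by rewrite -[X in P X]setIT -integral_indic//; apply: eq_integral => w _; rewrite !indicE.
have : P [set w | (M t w < y)%R] = P [set w | (M t w < x)%R] + P (M t @^-1` `[x, y[).
  rewrite -measureU//; last 2 first.
  - exact: mlt.
  - by apply/seteqP; split => w //= [wx]; rewrite in_itv/= => /andP[]; rewrite leNgt wx.
  congr (P _); apply/seteqP; split => w /=; rewrite in_itv/=.
    by move=> wy; case: (ltP (M t w) x) => wx; [left|right; rewrite wy].
  by move=> [/lt_le_trans|/andP[_ //]]; apply.
rewrite !left_cdfE// => E.
by rewrite EFinB E addrAC subee// add0e.
Qed.

(** For [y <= x] the scaled difference counts the samples in [[y, x[], a sum of Bernoulli variables;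
    both rates [mu] and [- mu] are at most 1. *)
Lemma expected_chernoff (x y L : R) (n : nat) : (0 <= L)%R ->
  \int[P]_w (chernoff_weight (n%:R * `|left_cdf x - left_cdf y|) L
    (n%:R * `|ecdf (M ^~ w) n x - ecdf (M ^~ w) n y|))%:E <= (2 * expR (- L))%:E.
Proof.
move=> L0; wlog yx : x y / (y <= x)%R.
  move=> wl; case: (leP y x) => [|/ltW xy]; first exact: wl.
  apply: le_trans (wl _ _ xy); rewrite le_eqVlt; apply/orP; left; apply/eqP.
  by apply: eq_integral => w _; rewrite distrC [in X in chernoff_weight _ _ (_ * X)]distrC.
set p := (left_cdf x - left_cdf y)%R.
have p0 : (0 <= p)%R by rewrite subr_ge0 left_cdf_mono.
pose h : R -> R := \1_(`[y, x[).
have mh : measurable_fun setT h by exact: measurable_indic.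
have h01 z : (0 <= h z <= 1)%R by rewrite /h indicE; case: (_ \in _); rewrite ?ler01 ?lexx.
have sumE w : (n%:R * `|ecdf (M ^~ w) n x - ecdf (M ^~ w) n y| =
    \sum_(1 <= s < n.+1) h (M s w))%R.
  have [->|n0] := posnP n; first by rewrite mul0r big_geq.
  rewrite ger0_norm ?subr_ge0 ?ecdf_mono// /ecdf -mulrBl mulrC divfK ?pnatr_eq0 -?lt0n//.
  rewrite -sumrB; apply: eq_bigr => s _; rewrite /h indicE mem_setE in_itv/=.
  case: (ltP (M s w) y) => [my|ym]; first by rewrite (lt_le_trans my yx) subrr.
  by rewrite subr0.
pose mu := chernoff_rate (n%:R * p) L.
have /andP[mu0 mu1] : (0 <= mu <= 1)%R by exact: chernoff_rate_01.
have mS : measurable_fun setT (fun w => \sum_(1 <= s < n.+1) h (M s w))%R.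
  apply: measurable_bigsum_nat => s /andP[s1 _].
  by apply: measurableT_comp => //; exact: mM.
pose u (l : R) w := (l * (\sum_(1 <= s < n.+1) h (M s w) - n%:R * p) -
    2 * (n%:R * p) * l ^+ 2)%R.
have mul l : measurable_fun setT (u l).
  by apply: measurable_funB => //; apply: measurable_funM => //; exact: measurable_funB.
have ub l : (l <= 1)%R -> \int[P]_w (expR (u l w - L))%:E <= (expR (- L))%:E.
  move=> l1; rewrite -[X in expR X]add0r; apply: integral_mulr_expR => //.
  rewrite expR0; apply: chernoff_supermartingale => //.
  by move=> t t1; exact: expectation_interval.
have -> : \int[P]_w (chernoff_weight (n%:R * `|p|) L
      (n%:R * `|ecdf (M ^~ w) n x - ecdf (M ^~ w) n y|))%:E =
    \int[P]_w (expR (u mu w - L) + expR (u (- mu) w - L))%:E.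
  by apply: eq_integral => w _; rewrite (ger0_norm p0) sumE /chernoff_weight -/mu /u sqrrN.
have -> : (2 * expR (- L) = expR (- L) + expR (- L))%R by ring.
have me l : measurable_fun setT (fun w => expR (u l w - L)).
  apply: measurableT_comp; first exact: measurable_expR.
  exact: measurable_funB.
apply: expectation_add_le => //.
- exact: ub.
- by apply: ub; lra.
Qed.

Lemma measurable_chernoff_weight (m L : R) (Y : Omega -> R) :
  measurable_fun setT Y -> measurable_fun setT (fun w => chernoff_weight m L (Y w)).
Proof.
move=> mY; apply: measurable_funD; (apply: measurableT_comp; first exact: measurable_expR);
  do 2 (apply: measurable_funB => //); apply: measurable_funM => //; exact: measurable_funB.
Qed.

Lemma measurable_ecdf_outcome n b : measurable_fun setT (fun w => ecdf (M ^~ w) n b).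
Proof. by apply: measurable_ecdf => s /andP[s1 _]; exact: mM. Qed.

Lemma measurable_cdf_failure bstar n :
  measurable_fun setT (fun w => cdf_failure left_cdf bstar (M ^~ w) n).
Proof.
have me := measurable_ecdf_outcome.
apply: measurable_funD.
  by apply: measurable_chernoff_weight; exact: measurable_funM.
apply: measurable_sum => k; apply: measurable_chernoff_weight.
apply: measurable_funM => //; apply: measurableT_comp; first exact: normr_measurable.
exact: measurable_funB.
Qed.

(** There are [n + 2] weights, each of expectation at most [2 / n ^ 2], and [2 * n + 4 <= 6 * n]. *)
Lemma expected_cdf_failure bstar n : (0 <= bstar)%R -> (0 < n)%N ->
  \int[P]_w (cdf_failure left_cdf bstar (M ^~ w) n)%:E <= (6 / n%:R)%:E.
Proof.
move=> b0 n0; have me := measurable_ecdf_outcome.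
have nR : (0 < n%:R :> R)%R by rewrite ltr0n.
pose L : R := (2 * ln n%:R)%R; have L0 : (0 <= L)%R by rewrite mulr_ge0// ln_nat_ge0.
have LE : (expR (- L) = n%:R^-1 * n%:R^-1)%R.
  by rewrite /L expRN mulr_natl mulr2n expRD lnK ?posrE// invfM.
apply: (@le_trans _ _ (2 * expR (- L) + \sum_(0 <= k < n.+1) 2 * expR (- L))%:E).
  apply: expectation_add_le.
  - by apply: measurable_chernoff_weight; exact: measurable_funM.
  - apply: measurable_sum => k; apply: measurable_chernoff_weight.
    apply: measurable_funM => //; apply: measurableT_comp; first exact: normr_measurable.
    exact: measurable_funB.
  - by move=> w; exact: chernoff_ge0.
  - by move=> w; rewrite sumr_ge0// => k _; exact: chernoff_ge0.
  (* The term at [bstar / 2] is read as an increment from 0, where both functions vanish. *)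
  - have E0 w : ecdf (M ^~ w) n 0 = 0%R.
      rewrite /ecdf big_nat big1 ?mul0r// => s /andP[s1 _].
      by rewrite ltNge; have /andP[-> _] := M01 w s1.
    have -> : \int[P]_w (chernoff_weight (n%:R * left_cdf (bstar / 2)) L
          (n%:R * ecdf (M ^~ w) n (bstar / 2)))%:E =
        \int[P]_w (chernoff_weight (n%:R * `|left_cdf (bstar / 2) - left_cdf 0|) L
          (n%:R * `|ecdf (M ^~ w) n (bstar / 2) - ecdf (M ^~ w) n 0|))%:E.
      apply: eq_integral => w _; rewrite (E0 w) (left_cdf_npos (lexx 0%R)) !subr0.
      by rewrite (ger0_norm (left_cdf_ge0 _)) (ger0_norm (ecdf_ge0 _ _ _)).
    exact: expected_chernoff.
  - apply: expectation_sum_le.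
    + move=> k; apply: measurable_chernoff_weight.
      apply: measurable_funM => //; apply: measurableT_comp; first exact: normr_measurable.
      exact: measurable_funB.
    + by move=> k w; exact: chernoff_ge0.
    + by move=> k _; exact: expected_chernoff.
rewrite lee_fin sumr_const_nat subn0 -[X in (_ + X)%R]mulr_natl LE -(@natr1 R n).
rewrite -subr_ge0.
have -> : (6 / n%:R - (2 * (n%:R^-1 / n%:R) + (n%:R + 1) * (2 * (n%:R^-1 / n%:R))) =
   4 * (n%:R - 1) * (n%:R^-1 / n%:R) :> R)%R by field; rewrite gt_eqF.
by rewrite !mulr_ge0 ?invr_ge0// ?subr_ge0 ?ler1n// ltW.
Qed.

Lemma measurable_win_outcome s : (1 <= s)%N ->
  measurable_fun setT (fun w => win gamma (V ^~ w) (M ^~ w) s).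
Proof.
by move=> s1; apply: measurable_win => // r /andP[r1 _]; [exact: mV|exact: mM].
Qed.

Lemma measurable_wins n : measurable_fun setT (fun w => wins gamma (V ^~ w) (M ^~ w) n).
Proof.
by apply: measurable_bigsum_nat => s /andP[s1 _]; exact: measurable_win_outcome.
Qed.

Lemma measurable_win_sum n :
  measurable_fun setT (fun w => win_sum gamma v (V ^~ w) (M ^~ w) n).
Proof.
apply: measurable_bigsum_nat => s /andP[s1 _]; apply: measurable_funM.
  by apply: measurable_funB => //; exact: mV.
exact: measurable_win_outcome.
Qed.

Let measurable_ucb_term (l r q : R) n : measurable_fun setT (fun w =>
  expR (l * win_sum gamma v (V ^~ w) (M ^~ w) n -
    (r * wins gamma (V ^~ w) (M ^~ w) n + q))%R).
Proof.
apply: measurableT_comp; first exact: measurable_expR.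
apply: measurable_funB; first by apply: measurable_funM => //; exact: measurable_win_sum.
by apply: measurable_funD => //; apply: measurable_funM => //; exact: measurable_wins.
Qed.

Lemma measurable_ucb_failure n :
  measurable_fun setT (fun w => ucb_failure gamma v (V ^~ w) (M ^~ w) n).
Proof. by apply: measurable_sum => k; apply: measurable_funD. Qed.

(** There are [n] pairs of exponentials, each exponential of expectation at most
    [n ^ (- gamma) <= n ^ (- 2)]. *)
Lemma expected_ucb_failure n : (2 <= gamma)%R -> (0 < n)%N ->
  \int[P]_w (ucb_failure gamma v (V ^~ w) (M ^~ w) n)%:E <= (2 / n%:R)%:E.
Proof.
move=> g2 n0; have nR : (0 < n%:R :> R)%R by rewrite ltr0n.
pose q : R := (gamma * ln n%:R)%R.
have qE : (expR (- q) <= n%:R^-1 * n%:R^-1)%R.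
  apply: (@le_trans _ _ (expR (- (2 * ln n%:R)))).
    by rewrite ler_expR lerN2 ler_wpM2r// ln_nat_ge0.
  by rewrite expRN mulr_natl mulr2n expRD lnK ?posrE// invfM.
have ub (l : R) : \int[P]_w (expR (l * win_sum gamma v (V ^~ w) (M ^~ w) n -
    (l ^+ 2 / 8 * wins gamma (V ^~ w) (M ^~ w) n + q)))%:E <= (expR (- q))%:E.
  under eq_integral do rewrite opprD addrA.
  rewrite -[X in expR X]add0r; apply: integral_mulr_expR.
    apply: measurable_funB; first by apply: measurable_funM => //; exact: measurable_win_sum.
    by apply: measurable_funM => //; exact: measurable_wins.
  by rewrite expR0; exact: hoeffding_supermartingale.
apply: (@le_trans _ _ (\sum_(1 <= k < n.+1) (expR (- q) + expR (- q)))%:E).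
  apply: expectation_sum_le.
  - by move=> k; apply: measurable_funD.
  - by move=> k w; rewrite addr_ge0// expR_ge0.
  - move=> k _; apply: expectation_add_le.
    + exact: measurable_ucb_term.
    + exact: measurable_ucb_term.
    + by move=> w; exact: expR_ge0.
    + by move=> w; exact: expR_ge0.
    + exact: ub.
    + by have := ub (- hoeffding_rate gamma n k)%R; rewrite sqrrN.
rewrite lee_fin sumr_const_nat subn1 /= -[leLHS]mulr_natl.
apply: (@le_trans _ _ (n%:R * (2 * (n%:R^-1 * n%:R^-1)))%R); last first.
  by rewrite le_eqVlt; apply/orP; left; apply/eqP; field; rewrite gt_eqF.
by rewrite ler_wpM2l// ?(ltW nR)//; lra.
Qed.

Lemma measurable_failure bstar n :
  measurable_fun setT (fun w => failure gamma v left_cdf bstar (V ^~ w) (M ^~ w) n).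
Proof.
apply: measurable_funD; [exact: measurable_cdf_failure|exact: measurable_ucb_failure].
Qed.

Lemma expected_failure_le bstar n : (0 <= bstar)%R -> (2 <= gamma)%R -> (0 < n)%N ->
  \int[P]_w (failure gamma v left_cdf bstar (V ^~ w) (M ^~ w) n)%:E <= (8 / n%:R)%:E.
Proof.
move=> b0 g2 n0; have -> : (8 / n%:R = 6 / n%:R + 2 / n%:R :> R)%R.
  by rewrite -mulrDl; congr (_ / _)%R; lra.
apply: expectation_add_le.
- exact: measurable_cdf_failure.
- exact: measurable_ucb_failure.
- by move=> w; exact: cdf_failure_ge0.
- by move=> w; exact: ucb_failure_ge0.
- exact: expected_cdf_failure.
- exact: expected_ucb_failure.
Qed.

End expected_failure.

(** * Summation *)

Section rate_sums.
Context {R : realType}.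
Variable a : R.
Hypothesis a0 : 0 < a.

Lemma rate_sqr n : rate a n ^+ 2 = n%:R `^ (2 * a - 2 / 3).
Proof. by rewrite -powR_mulrn ?powR_ge0// -powRrM; congr (_ `^ _); lra. Qed.

Lemma third_le_rate_sqr n : (0 < n)%N -> n%:R `^ (- (2 / 3)) <= rate a n ^+ 2.
Proof. by move=> n0; rewrite rate_sqr ler_powR ?ler1n//; move: a0; lra. Qed.

Lemma inv_le_third n : (0 < n)%N -> n%:R^-1 <= n%:R `^ (- (2 / 3)) :> R.
Proof. by move=> n0; rewrite -powR_inv1 ?ler0n// ler_powR ?ler1n//; lra. Qed.

(** Bounding [1 / m] by [m ^ (- 2 / 3)] avoids a logarithm: the sum is at most [3 * n ^ (1 / 3)]. *)
Lemma harmonic_mean_le_rate n : (0 < n)%N ->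
  (\sum_(1 <= m < n) m%:R^-1) / n%:R <= 3 * rate a n ^+ 2.
Proof.
move=> n0; have nR : 0 < n%:R :> R by rewrite ltr0n.
apply: (@le_trans _ _ (3 * n%:R `^ (- (2 / 3)))); last first.
  by rewrite ler_wpM2l// third_le_rate_sqr.
rewrite ler_pdivrMr//.
apply: (@le_trans _ _ (\sum_(1 <= m < n.+1) m%:R `^ (- (2 / 3)))).
  rewrite big_nat_recr//= -[leLHS]addr0 lerD ?powR_ge0//.
  by rewrite big_nat [leRHS]big_nat ler_sum// => m /andP[m0 _]; exact: inv_le_third.
apply: le_trans (sum_powR_third n) _.
rewrite -mulrA ler_wpM2l// -[X in _ * X](powRr1 (ltW nR)) -powRD.
  by rewrite le_eqVlt; apply/orP; left; apply/eqP; congr (_ `^ _); lra.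
by apply/implyP => _; rewrite gt_eqF.
Qed.

(** The factor [m ^ (2 * a)] is at most [n ^ (2 * a)] and comes out of the sum. *)
Lemma sum_rate_sqr n : (0 < n)%N ->
  \sum_(1 <= m < n.+1) rate a m ^+ 2 <= 3 * n%:R `^ (3^-1 + 2 * a).
Proof.
move=> n0; have nR : 0 < n%:R :> R by rewrite ltr0n.
apply: (@le_trans _ _ (n%:R `^ (2 * a) * \sum_(1 <= m < n.+1) m%:R `^ (- (2 / 3)))).
  rewrite mulr_sumr big_nat [leRHS]big_nat ler_sum// => m /andP[m0 mn].
  rewrite rate_sqr powRD; last by apply/implyP => _; rewrite pnatr_eq0 -lt0n.
  rewrite ler_wpM2r ?powR_ge0// ge0_ler_powR ?nnegrE ?ler0n ?ler_nat//.
  by rewrite mulr_ge0// ltW.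
apply: le_trans (ler_wpM2l (powR_ge0 _ _) (sum_powR_third n)) _.
rewrite mulrCA ler_wpM2l// -powRD; last by apply/implyP => _; rewrite gt_eqF.
by rewrite addrC.
Qed.

End rate_sums.

(** * The regret as a sum of expected gaps *)

Section regret_of_gaps.
Context {d : measure_display} {Omega : measurableType d} {R : realType}
  (P : probability Omega R).
Variables (gamma v bstar : R) (F : R -> R) (V M : nat -> Omega -> R).
Hypothesis mV : forall t, (1 <= t)%N -> measurable_fun setT (V t).
Hypothesis mM : forall t, (1 <= t)%N -> measurable_fun setT (M t).
Hypothesis Fmono : forall x y : R, x <= y -> F x <= F y.
Hypothesis F_ge0 : forall x, 0 <= F x.
Hypothesis F_le1 : forall x, F x <= 1.
Hypothesis v01 : 0 <= v <= 1.
Hypothesis bstar01 : 0 <= bstar <= 1.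
Hypothesis bstar_max : forall b : R, 0 <= b <= 1 -> util v F b <= util v F bstar.

Definition bid_gap (t : nat) (w : Omega) : R :=
  util v F bstar - util v F (ucbid_bid gamma (V ^~ w) (M ^~ w) t).

Lemma bid_gap_ge0 t w : (1 <= t)%N -> 0 <= bid_gap t w.
Proof. by move=> t1; rewrite subr_ge0 bstar_max// ucbid_bid01. Qed.

Lemma bid_gap_le2 t w : (1 <= t)%N -> bid_gap t w <= 2.
Proof.
move=> t1; apply: util_diff_le2 => //; first exact: ucbid_bid01.
by move=> x; rewrite F_ge0 F_le1.
Qed.

Lemma measurable_bid_gap t : (1 <= t)%N -> measurable_fun setT (bid_gap t).
Proof.
move=> t1; have mB : measurable_fun setT (fun w => ucbid_bid gamma (V ^~ w) (M ^~ w) t).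
  by apply: measurable_ucbid_bid => // s /andP[s1 _]; [exact: mV|exact: mM].
apply: measurable_funB => //; apply: measurable_funM; first exact: measurable_funB.
by apply: measurableT_comp => //; exact: nondecreasing_measurable.
Qed.

Local Open Scope ereal_scope.

Lemma integral_probability_cst (c : R) : \int[P]_w c%:E = c%:E.
Proof. by rewrite integral_cst// [X in _ * X](@probability_setT _ _ _ P) mule1. Qed.

Lemma integral_bid_gap_fin t : (1 <= t)%N ->
  \int[P]_w (bid_gap t w)%:E \is a fin_num.
Proof.
move=> t1; rewrite ge0_fin_numE; last first.
  by apply: integral_ge0 => w _; rewrite lee_fin bid_gap_ge0.
apply: (@le_lt_trans _ _ (\int[P]_w 2%:E)).
  apply: ge0_le_integral => //.
  - by move=> w _; rewrite lee_fin bid_gap_ge0.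
  - exact/measurable_EFinP/measurable_bid_gap.
  - by move=> w _; rewrite lee_fin bid_gap_le2.
by rewrite integral_probability_cst ltry.
Qed.

Lemma expectation_bid_util t : (1 <= t)%N ->
  'E_P[fun w => util v F (ucbid_bid gamma (V ^~ w) (M ^~ w) t)] =
  (util v F bstar)%:E - \int[P]_w (bid_gap t w)%:E.
Proof.
move=> t1; rewrite unlock.
transitivity (\int[P]_w ((util v F bstar)%:E - (bid_gap t w)%:E)).
  by apply: eq_integral => w _; rewrite -EFinB /bid_gap subKr.
rewrite (@integralB_EFin _ _ _ P setT (cst (util v F bstar)) (bid_gap t)) //.
- by rewrite integral_probability_cst.
- exact: finite_measure_integrable_cst.
- apply/integrableP; split; first exact/measurable_EFinP/measurable_bid_gap.
  under eq_integral do rewrite /= ger0_norm ?bid_gap_ge0//.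
  have := integral_bid_gap_fin t1; rewrite ge0_fin_numE//.
  by apply: integral_ge0 => w _; rewrite lee_fin bid_gap_ge0.
Qed.

Lemma regret_bid_gap T : regret P gamma v F bstar V M T =
  \sum_(1 <= t < T.+1) \int[P]_w (bid_gap t w)%:E.
Proof.
rewrite /regret.
have E t : (1 <= t < T.+1)%N -> 'E_P[fun w => util v F (ucbid_bid gamma (V ^~ w) (M ^~ w) t)] =
    (util v F bstar - fine (\int[P]_w (bid_gap t w)%:E))%:E.
  by move=> /andP[t1 _]; rewrite expectation_bid_util// EFinB fineK// integral_bid_gap_fin.
rewrite (eq_big_nat _ _ E) sumEFin -EFinB sumrB sumr_const_nat subn1 /=.
rewrite -[(util v F bstar *+ T)%R]mulr_natl opprB addrCA subrr addr0 -sumEFin.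
by apply: eq_big_nat => t /andP[t1 _]; rewrite fineK// integral_bid_gap_fin.
Qed.

End regret_of_gaps.

Theorem theorem6 (R : realType) (d : measure_display) (Omega : measurableType d)
  (P : probability Omega R) (V M : nat -> Omega -> R) (v : R) (F f : R -> R)
  (bstar Delta c_f C_f lambda gamma eps : R) :
  (* (V_t)_{t>=1} i.i.d. in [0,1] with mean v *)
  (forall t, (1 <= t)%N -> measurable_fun setT (V t)) ->
  (forall t w, (1 <= t)%N -> 0 <= V t w <= 1) ->
  (forall t A, (1 <= t)%N -> measurable A -> P (V t @^-1` A) = P (V 1%N @^-1` A)) ->
  ('E_P[V 1%N] = v%:E)%E ->
  (* (M_t)_{t>=1} i.i.d. in [0,1] with CDF F *)
  (forall t, (1 <= t)%N -> measurable_fun setT (M t)) ->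
  (forall t w, (1 <= t)%N -> 0 <= M t w <= 1) ->
  (forall t x, (1 <= t)%N -> P [set w | M t w <= x] = (F x)%:E) ->
  (* all the V_t, M_t (t >= 1) mutually independent *)
  mutually_independent P [set i : bool * nat | (1 <= i.2)%N]
    (fun i => if i.1 then V i.2 else M i.2) ->
  (* Assumption 1 *)
  (forall x : R, x \in `]0, 1[ -> is_derive x 1 F (f x)) ->
  {in `]0, 1[, continuous f} ->
  (forall x y, x \in `]0, 1[ -> y \in `]0, 1[ -> x < y -> f y / F y < f x / F x) ->
  (* b* = max argmax U_{v,F} *)
  is_max_argmax (util v F) bstar ->
  (* Assumption 2 *)
  0 < Delta ->
  (forall b, b \in `[bstar - Delta, bstar + Delta] -> c_f < f b < C_f) ->
  (forall b : R, b \in `[bstar, bstar + Delta] ->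
     exists D : R, is_derive b 1 (fun x : R => x + F x / f x) D /\ D <= lambda) ->
  0 < F bstar ->
  2 < gamma -> 0 < eps ->
  exists C : R, exists T0 : nat, forall T : nat, (T0 <= T)%N ->
    (`| regret P gamma v F bstar V M T | <= (C * (T%:R `^ (3^-1 + eps)))%:E)%E.
Proof.
move=> mV V01 Vid EV' mM M01 MF indX dF' _ lc' [bs01' [bmax' _]] Delta0 fb dphi' Fbs g2 eps0.
have EV : (\int[P]_w (V 1%N w)%:E)%E = v%:E by rewrite -EV' unlock.
have bs01 : 0 <= bstar <= 1 by rewrite in_itv/= in bs01'.
have bmax (b : R) : 0 <= b <= 1 -> util v F b <= util v F bstar.
  by move=> b01; apply: bmax'; rewrite in_itv.
have dF (x : R) : 0 < x < 1 -> is_derive x (1 : R) F (f x).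
  by move=> x01; apply: dF'; rewrite in_itv.
have lc (x y : R) : 0 < x -> x < y -> y < 1 -> f y / F y < f x / F x.
  by move=> x0 xy y1; apply: lc' => //; rewrite in_itv/=; apply/andP; split; lra.
have flt (b : R) : bstar - Delta <= b <= bstar + Delta -> f b < C_f.
  by move=> bb; have /andP[] := fb b ltac:(by rewrite in_itv).
have dphi : exists D, is_derive bstar (1 : R) (fun x : R => x + F x / f x) D.
  have [|D [? _]] := dphi' bstar; last by exists D.
  by rewrite in_itv/= lexx lerDl ltW.
have v01 := mean01 mV V01 EV.
have Fmono := cdf_mono mM MF.
have F0 := cdf_ge0 MF; have F1 := cdf_le1 mM MF; have Fneg := cdf_neg M01 MF.
pose G := left_cdf P M.
have Gmono := left_cdf_mono mM MF.
have G0 := left_cdf_ge0 P M; have G1 := left_cdf_le1 mM MF.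
have Gnpos := left_cdf_npos mM M01 MF; have GF := left_cdf_le mM MF.
have Gin (b : R) : 0 < b < 1 -> G b = F b.
  by move=> b01; exact: (left_cdf_derivable mM MF (dF b b01)).
have bv := bstar_lt_v Fmono F0 Fneg dF lc v01 bs01 bmax Delta0 flt dphi Fbs.
have b0 := bstar_gt0 Fmono F0 Fneg dF lc bs01 Delta0 flt dphi Fbs.
have U0 := util_bstar_gt0 Fmono F0 Fneg dF lc v01 bs01 bmax Delta0 flt dphi Fbs.
have gap := utility_gap Fmono F0 Fneg dF lc v01 bs01 bmax Delta0 flt dphi Fbs G0 Gnpos Gin.
have [Lam Lam1 GLam] := G_lipschitz_at Fmono F0 F1 Fneg dF lc v01 bs01 bmax Delta0
  flt dphi Fbs GF G0 Gin.
have [dl dl0 [LF LF0 [dlb dl1 Flip]]] := cdf_lipschitz_near Fmono F0 Fneg dF lc v01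
  bs01 bmax Delta0 flt dphi Fbs.
have [_ v1] := andP v01.
have bs1 : 0 < bstar < 1 by rewrite b0 (lt_le_trans bv).
have Ghalf : 0 < G (bstar / 2).
  have hb : 0 < bstar / 2 < 1 by lra.
  by rewrite Gin//; have [] := density_cdf_gt0 Fmono F0 dF lc hb.
have k0 : 0 < util v F bstar / 4 by rewrite divr_gt0.
have k1 : util v F bstar / 4 <= 1.
  by have := F0 bstar; have := F1 bstar; rewrite /util; nra.
have gap' (b : R) : 0 <= b <= 1 -> util v F bstar / 4 * (b - bstar) ^+ 2 <=
    (v - bstar) * G bstar - (v - b) * G b.
  by move=> b01; rewrite (Gin bstar)//; exact: gap.
(* The squared rates sum to order [T ^ (1 / 3 + 2 * a)], whence [eps / 2]; the cap 1/6 keeps [a]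
   below 1/3, so that the rate tends to 0. *)
pose a : R := Num.min (eps / 2) 6^-1.
have a0 : 0 < a by rewrite lt_min invr_gt0 divr_gt0//= ltr0n.
have a6 : a <= 6^-1 by rewrite ge_min lexx orbT.
have ae : a <= eps / 2 by rewrite ge_min lexx.
have a1 : a < 3^-1 by lra.
have bsv : 0 < bstar < v by rewrite b0.
have gamma0 : 0 <= gamma by lra.
have [C C0 HC] := pointwise_gap bsv v1 gamma0 F0 F1 Gmono G0 G1 (Gnpos 0 (lexx 0))
  Gin Ghalf k0 k1 gap' Lam1 GLam dl0 LF0 dlb dl1 Flip a0 a1.
pose gp := bid_gap gamma v bstar F V M.
have mgp := measurable_bid_gap gamma v bstar mV mM Fmono.
(* [33 = 1 + 8 + 24]: the squared rate, the expected failure [8 / n], and the average of the earlier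
   ones, bounded through [3 * 8]. *)
have egap n : (0 < n)%N -> (\int[P]_w (gp n.+1 w)%:E <= (C * (33 * rate a n ^+ 2))%:E)%E.
  move=> n0.
  pose fl m w := failure gamma v G bstar (V ^~ w) (M ^~ w) m.
  have fl0 m w : 0 <= fl m w by exact: failure_ge0.
  have mfl m : measurable_fun setT (fl m) by exact: measurable_failure.
  have Efl m : (0 < m)%N -> (\int[P]_w (fl m w)%:E <= (8 / m%:R)%:E)%E.
    move=> m0.
    by apply: (expected_failure_le mV V01 Vid EV mM M01 indX MF) => //; exact: ltW.
  have mS : measurable_fun setT (fun w => \sum_(1 <= m < n) fl m w).
    exact: measurable_sum.
  have S0 w : 0 <= \sum_(1 <= m < n) fl m w by rewrite sumr_ge0.
  have ni0 : 0 <= n%:R^-1 :> R by rewrite invr_ge0.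
  apply: (@le_trans _ _ (\int[P]_w (C * (rate a n ^+ 2 + fl n w +
      (\sum_(1 <= m < n) fl m w) / n%:R))%:E)%E).
    apply: ge0_le_integral => //.
    - by move=> w _; rewrite lee_fin bid_gap_ge0.
    - exact/measurable_EFinP/mgp.
    - apply/measurable_EFinP; apply: measurable_funM => //; apply: measurable_funD.
        exact: measurable_funD.
      exact: measurable_funM.
    - move=> w _; rewrite lee_fin; apply: HC => // s s1; exact: M01.
  have scale (c b : R) (X : Omega -> R) : 0 <= c -> measurable_fun setT X ->
      (forall w, 0 <= X w) -> (\int[P]_w (X w)%:E <= b%:E)%E ->
      (\int[P]_w (c * X w)%:E <= (c * b)%:E)%E.
    move=> c0 mX X0 Xb; under eq_integral do rewrite EFinM.
    rewrite ge0_integralZl_EFin//.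
    - by rewrite EFinM lee_wpmul2l.
    - by move=> w _; rewrite lee_fin.
    - exact/measurable_EFinP.
  apply: (scale) => //.
  - apply: measurable_funD; first exact: measurable_funD.
    exact: measurable_funM.
  - move=> w; apply: addr_ge0; last exact: mulr_ge0.
    by apply: addr_ge0 => //; exact: sqr_ge0.
  have third := third_le_rate_sqr a0 n0; have inv := @inv_le_third R n n0.
  have harm := harmonic_mean_le_rate a0 n0.
  apply: (@le_trans _ _ (rate a n ^+ 2 + 8 / n%:R +
      n%:R^-1 * \sum_(1 <= m < n) (8 / m%:R))%:E); last first.
    rewrite lee_fin -mulr_sumr mulrCA [n%:R^-1 * _]mulrC.
    have nr : n%:R^-1 <= rate a n ^+ 2 by exact: le_trans inv third.
    lra.
  apply: expectation_add_le => //.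
  - exact: measurable_funD.
  - exact: measurable_funM.
  - by move=> w; rewrite addr_ge0 ?sqr_ge0.
  - by move=> w; rewrite divr_ge0.
  - apply: expectation_add_le => //.
    + by move=> w; exact: sqr_ge0.
    + by rewrite integral_probability_cst.
    + exact: Efl.
  - under eq_integral do rewrite mulrC.
    apply: (scale) => //; apply: expectation_sum_le => // m /andP[m0 _].
    exact: Efl.
(* The 2 pays for the first round, which precedes all data; [99 = 33 * 3], with the 3 of
   [sum_rate_sqr]. *)
exists (2 + 99 * C), 1%N => T T1.
have TR : 1 <= T%:R :> R by rewrite ler1n.
rewrite (regret_bid_gap P gamma mV mM Fmono F0 F1 v01 bs01 bmax).
have gp0 t w : (1 <= t)%N -> 0 <= gp t w by exact: bid_gap_ge0.
rewrite gee0_abs; last first.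
  rewrite big_nat_cond sume_ge0// => t /andP[/andP[t1 _] _].
  by apply: integral_ge0 => w _; rewrite lee_fin gp0.
rewrite big_ltn// big_add1 /=.
have g1 : (\int[P]_w (gp 1%N w)%:E <= 2%:E)%E.
  apply: (@le_trans _ _ (\int[P]_w 2%:E)%E).
    apply: ge0_le_integral => //.
    - by move=> w _; rewrite lee_fin gp0.
    - exact/measurable_EFinP/mgp.
    - by move=> w _; rewrite lee_fin; exact: bid_gap_le2.
  by rewrite integral_probability_cst.
have powT : T%:R `^ (3^-1 + 2 * a) <= T%:R `^ (3^-1 + eps) by rewrite ler_powR//; lra.
have pow1 : 1 <= T%:R `^ (3^-1 + eps) :> R.
  by rewrite -[leLHS](powRr0 T%:R) ler_powR//; lra.
have sumle : \sum_(1 <= n < T) C * (33 * rate a n ^+ 2) <= C * (99 * T%:R `^ (3^-1 + eps)).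
  rewrite -!mulr_sumr ler_wpM2l//.
  have h : \sum_(1 <= n < T) rate a n ^+ 2 <= \sum_(1 <= n < T.+1) rate a n ^+ 2.
    by rewrite [leRHS]big_nat_recr//= lerDl sqr_ge0.
  have := sum_rate_sqr a0 T1; lra.
apply: (@le_trans _ _ (2%:E + (\sum_(1 <= n < T) C * (33 * rate a n ^+ 2))%:E)%E).
  apply: leeD => //; rewrite -sumEFin big_nat_cond [leRHS]big_nat_cond.
  by apply: lee_sum => n /andP[/andP[n0 _] _]; exact: egap.
rewrite -EFinD lee_fin mulrDl; move: (T%:R `^ (3^-1 + eps)) pow1 sumle => z z1 sumle.
lra.
Qed.
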